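(* There is a universal constant $c>0$ such that for every $B\ge1$ and every even $H\ge2$ there is a family of blockwise group-floor instances, with $K=2B+1$ arms, $B$ blocks of length $H$, disjoint groups of size two (arm degree $t=1$), and in each block $b$ a group floor $H/2$ on one fresh group $g_b$ (a different group for each block, all other floors in the block being zero), on which every blockwise-group-fair policy $\pi$ satisfies $$\sup_{\mathrm{family}}\bigl[\mathrm{OPT}^{\mathrm{frac}}-\mathbb E[V^\pi]\bigr]\ \ge\ c\,B\sqrt H,$$ where $\mathrm{OPT}^{\mathrm{frac}}$ is the sum of per-block fractional group-fair optima and $V^\pi=\sum_{\tau=1}^{T}\mu_{A_\tau}$. Since $T=BH$, the bound is $c\sqrt B\cdot\sqrt T$. In contrast, the same instances admit a fixed-plan comparator against which Group-BDQ-UCB achieves, with probability at least $1-\eta$, regret $O(\sqrt{KRL})$, where $L=\log(2KT/\eta)$ and $R$ is the number of residual rounds.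
   Context: Bandit: arm $i\in[K]$ produces independent rewards in $[0,1]$ with mean $\mu_i$ (i.i.d. within an arm); $A_\tau$ is the arm pulled at round $\tau$. Group floors: the horizon $T$ is partitioned into $B$ consecutive blocks, block $b$ of length $H_b$; $\mathcal G$ is a collection of subsets of $[K]$; block $b$ requires $\sum_{i\in g}N_{b,i}\ge f_{b,g}$ for each $g\in\mathcal G$, where $N_{b,i}$ is the number of pulls of arm $i$ in block $b$. A policy is blockwise-group-fair if this holds always. The arm degree $t$ is the maximum number of groups containing an arm. $\mathrm{OPT}^{\mathrm{frac}}=\sum_bV_b^{\mathrm{frac}}$ with $V_b^{\mathrm{frac}}=\max\{\sum_i\mu_iy_i:y\ge0,\ \sum_{i\in g}y_i\ge f_{b,g}\ \forall g,\ \sum_iy_i=H_b\}$. Group-BDQ-UCB with fixed plan: in each block $b$ a fractional plan $x_b\ge0$ with $\sum_{i\in g}x_{b,i}\ge f_{b,g}+t$ for all $g$ carrying a floor in the block and $\sum_i\lceil x_{b,i}\rceil\le H_b$ is given; it is rounded (Beck--Fiala) to integers $n_{b,i}\in\{\lfloor x_{b,i}\rfloor,\lceil x_{b,i}\rceil\}$ meeting all group floors; arm $i$ is pulled $n_{b,i}$ times, and the $R_b=H_b-\sum_in_{b,i}$ remaining rounds pull an arm maximizing $\widehat\mu_i+\sqrt{2L/N_i}$ ($+\infty$ if unobserved; all observations used). $R=\sum_bR_b$. The fixed-plan comparator executes the same mandatory allocations $(n_b)$ and assigns every residual round to a best arm; regret is the comparator's mean value minus $\sum_\tau\mu_{A_\tau}$.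 *)

(* Defs.v *)
From mathcomp Require Import all_boot all_order all_algebra.
From mathcomp Require Import all_classical all_reals all_analysis.
Set Implicit Arguments.
Unset Strict Implicit.
Unset Printing Implicit Defensive.
Import Order.TTheory GRing.Theory Num.Theory.
Import numFieldNormedType.Exports.
Local Open Scope classical_set_scope.
Local Open Scope ring_scope.

(* The part of a blockwise group-floor instance that is known to the learner;
   an instance is completed by the reward laws of the arms (see [arm_laws]).
   Blocks are consecutive and rounds are numbered from 0. *)
Record floors (K B : nat) := Floors {
  blen : 'I_B -> nat;
  groups : {set {set 'I_K}};
  gfloor : 'I_B -> {set 'I_K} -> nat
}.

Section Blocks.
Context {K B : nat} (I : floors K B).

Definition horizon : nat := (\sum_(b < B) blen I b)%N.

Definition bstart (b : 'I_B) : nat :=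
  (\sum_(b' < B | (b' < b)%N) blen I b')%N.

Definition bend (b : 'I_B) : nat := (bstart b + blen I b)%N.

Definition arm_degree : nat :=
  (\max_(i < K) #|[pred g in groups I | i \in g]|)%N.

End Blocks.

Section Laws.
Context {R : realType} {K : nat}.

Definition arm_laws := 'I_K -> probability (measurableTypeR R) R.

Definition unit_laws (nu : arm_laws) : Prop :=
  forall i, nu i `[0, 1]%classic = 1%E.

Definition arm_mean (nu : arm_laws) (i : 'I_K) : R := \int[nu i]_x x.

End Laws.
Arguments arm_laws : clear implicits.

Section OPTfrac.
Context {R : realType} {K B : nat} (I : floors K B) (mu : 'I_K -> R).

Definition frac_feasible (b : 'I_B) (y : 'I_K -> R) : Prop :=
  [/\ forall i, 0 <= y i,
      forall g, g \in groups I -> (gfloor I b g)%:R <= \sum_(i in g) y i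
    & \sum_i y i = (blen I b)%:R].

Definition Vfrac (b : 'I_B) : R :=
  sup [set \sum_i mu i * y i | y in frac_feasible b].

Definition OPTfrac : R := \sum_(b < B) Vfrac b.

End OPTfrac.

Section Policies.
Context {R : realType} {K B : nat}.

(* A policy maps its internal randomization (a seed in U) and the history of
   (arm, observed reward) pairs, oldest first, to the next arm. *)
Definition history : Type := seq ('I_K * R).
Definition policy (U : Type) : Type := U -> history -> 'I_K.

(* Joint measurability in the seed, the past arms (a discrete variable) and the
   past rewards. *)
Definition measurable_policy d (U : measurableType d) (pi : policy U) : Prop :=
  forall (n : nat) (a : n.-tuple 'I_K) (i : 'I_K),
    measurable [set p : U * n.-tuple (measurableTypeR R) |
                 pi p.1 (zip a p.2) = i].

Definition pulls (h : history) (i : 'I_K) : nat := count (fun p => p.1 == i) h.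

Definition emp_mean (h : history) (i : 'I_K) : R :=
  (\sum_(p <- h | p.1 == i) p.2) / (pulls h i)%:R.

(* x i s is the reward returned by pull number s (counted from 0) of arm i. *)
Definition reward_table : Type := 'I_K -> nat -> R.

Definition in01 (x : reward_table) : Prop := forall i s, 0 <= x i s <= 1.

Section Run.
Context {U : Type} (pi : policy U) (u : U) (x : reward_table).

Fixpoint run (n : nat) : history :=
  if n is m.+1 then
    let h := run m in let a := pi u h in rcons h (a, x a (pulls h a))
  else [::].

Definition arm_at (t : nat) : 'I_K := pi u (run t).

(* Number of pulls of arm i in the rounds s, ..., e - 1. *)
Definition pulls_in (s e : nat) (i : 'I_K) : nat :=
  (\sum_(s <= t < e) (arm_at t == i))%N.

End Run.

Definition group_fair {U : Type} (I : floors K B) (pi : policy U) : Prop :=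
  forall (u : U) (x : reward_table), in01 x ->
  forall (b : 'I_B) (g : {set 'I_K}), g \in groups I ->
    (gfloor I b g <= \sum_(i in g) pulls_in pi u x (bstart I b) (bend I b) i)%N.

(* V^pi, the sum of the means of the arms pulled. *)
Definition policy_value {U : Type} (I : floors K B) (mu : 'I_K -> R)
    (pi : policy U) (u : U) (x : reward_table) : R :=
  \sum_(t < horizon I) mu (arm_at pi u x t).

(* Under P, the seed has law PU, X i s has law nu i, and all these variables are
   mutually independent: their joint law is the product law on every measurable
   rectangle. *)
Definition bandit_env d (Omega : measurableType d) d' (U : measurableType d')
    (PU : probability U R) (nu : arm_laws R K) (P : probability Omega R)
    (seed : Omega -> U) (X : 'I_K -> nat -> Omega -> measurableTypeR R) : Prop :=
  [/\ measurable_fun setT seed,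
      forall i s, measurable_fun setT (X i s)
    & forall (n : nat) (D : set U) (E : 'I_K -> 'I_n -> set (measurableTypeR R)),
        measurable D -> (forall i s, measurable (E i s)) ->
        P [set w | D (seed w) /\ forall (i : 'I_K) (s : 'I_n), E i s (X i s w)]
        = (PU D * \prod_(i < K) \prod_(s < n) nu i (E i s))%E].

Definition table_at (T : Type) (X : 'I_K -> nat -> T -> R) (w : T) : reward_table :=
  fun i s => X i s w.

End Policies.
Arguments history : clear implicits.
Arguments policy : clear implicits.
Arguments reward_table : clear implicits.

Section GroupBDQUCB.
Context {R : realType} {K B : nat} (I : floors K B).

Definition fractional_plan (x : 'I_B -> 'I_K -> R) : Prop :=
  forall b,
  [/\ forall i, 0 <= x b i,
      forall g, g \in groups I -> (0 < gfloor I b g)%N ->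
        (gfloor I b g + arm_degree I)%:R <= \sum_(i in g) x b i
    & \sum_i Num.ceil (x b i) <= (blen I b)%:Z].

Definition rounding (x : 'I_B -> 'I_K -> R) (n : 'I_B -> 'I_K -> nat) : Prop :=
  forall b,
    (forall i, (n b i)%:Z = Num.floor (x b i) \/ (n b i)%:Z = Num.ceil (x b i)) /\
    (forall g, g \in groups I -> (gfloor I b g <= \sum_(i in g) n b i)%N).

Context (n : 'I_B -> 'I_K -> nat).

Definition mandatory (b : 'I_B) : nat := (\sum_(i < K) n b i)%N.

Definition residual : nat := (\sum_(b < B) (blen I b - mandatory b))%N.

Definition ucb_index (L : R) (h : history R K) (i : 'I_K) : \bar R :=
  if pulls h i == 0%N then +oo%E
  else (emp_mean h i + Num.sqrt (2 * L / (pulls h i)%:R))%:E.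

(* The order of the mandatory pulls inside a block and the tie-breaking among
   maximizers of the index are left free. *)
Definition group_bdq_ucb {U : Type} (L : R) (pi : policy R K U) : Prop :=
  forall (u : U) (x : reward_table R K), in01 x -> forall b : 'I_B,
    (forall i,
       pulls_in pi u x (bstart I b) (bstart I b + mandatory b)%N i = n b i) /\
    (forall t, (bstart I b + mandatory b <= t < bend I b)%N ->
       forall j, (ucb_index L (run pi u x t) j
                  <= ucb_index L (run pi u x t) (arm_at pi u x t))%E).

Definition comparator_value (mu : 'I_K -> R) : R :=
  \sum_(b < B) \sum_(i < K) (n b i)%:R * mu i
  + residual%:R * sup (range mu).

Definition plan_regret {U : Type} (mu : 'I_K -> R) (pi : policy R K U)
    (u : U) (x : reward_table R K) : R :=
  comparator_value mu - policy_value I mu pi u x.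

End GroupBDQUCB.

(* Main.v *)
(* Block b has a known arm of mean 1/4 and a coin arm that pays 1/2 with
   probability 1/2 + e or 1/2 - e, where e = 1 / (4 sqrt (H / 2)); one more arm
   always pays 1. Since this safe arm beats every pull that the floor does not
   force, the regret splits over the groups, and group b costs at least e / 2 for
   each of its first H / 2 pulls, at whatever time, that goes to its worse arm.
   Whether the coin arm is pulled more than k < H / 2 times depends only on its
   first H / 2 rewards, whose laws for the two biases have affinity bounded below
   by Le Cam's inequality. Averaging over all sign vectors yields B sqrt H.

   For the upper bound, all rewards outside the safe arm are at most 1/2, so the
   index of an unsafe arm with more than 8 L pulls is below 1, hence below that of
   the safe arm. Almost surely the regret is thus at most the number Q of residual
   pulls of unsafe arms, and Q <= R, Q <= K (8 L + 1) give Q^2 <= 16 K R L. *)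

From HB Require Import structures.
Require Import Defs.
From mathcomp Require Import all_boot all_order all_algebra.
From mathcomp Require Import all_classical all_reals all_analysis.
From mathcomp Require Import measurable_realfun ring lra zify.
Set Implicit Arguments.
Unset Strict Implicit.
Unset Printing Implicit Defensive.
Import Order.TTheory GRing.Theory Num.Theory.
Import numFieldNormedType.Exports.
Local Open Scope classical_set_scope.
Local Open Scope ring_scope.

(** * Runs of a policy *)

Section run_theory.
Context {R : realType} {K : nat} {U : Type} (pi : policy R K U) (u : U).
Implicit Types (x : reward_table R K) (i : 'I_K).

Lemma size_run x n : size (run pi u x n) = n.
Proof. by elim: n => //= n IH; rewrite size_rcons IH. Qed.

Lemma unzip1_run x n : unzip1 (run pi u x n) = mkseq (arm_at pi u x) n.
Proof. by elim: n => //= n IH; rewrite mkseqS /unzip1 map_rcons -/(unzip1 _) IH. Qed.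

Lemma pullsE (h : history R K) i : pulls h i = count_mem i (unzip1 h).
Proof. by rewrite /pulls /unzip1 count_map. Qed.

Lemma pulls_le_size (h : history R K) i : (pulls h i <= size h)%N.
Proof. exact: count_size. Qed.

Lemma pulls_rcons (h : history R K) p i :
  pulls (rcons h p) i = (pulls h i + (p.1 == i))%N.
Proof. by rewrite /pulls -cats1 count_cat /= addn0. Qed.

Lemma pulls_run x n i : pulls (run pi u x n) i = pulls_in pi u x 0 n i.
Proof.
elim: n => [|n IH] /=; first by rewrite /pulls_in big_geq.
by rewrite pulls_rcons IH /pulls_in big_nat_recr.
Qed.

Lemma sum_arm_at (V : nmodType) (F : 'I_K -> V) x n :
  \sum_(t < n) F (arm_at pi u x t) = \sum_(a <- unzip1 (run pi u x n)) F a.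
Proof.
rewrite unzip1_run /mkseq big_map.
by rewrite -(big_mkord xpredT (fun t => F (arm_at pi u x t))) /index_iota subn0.
Qed.

Lemma sum_pulls_in (F : 'I_K -> R) x s e :
  \sum_(s <= t < e) F (arm_at pi u x t)
  = \sum_i (pulls_in pi u x s e i)%:R * F i.
Proof.
under [RHS]eq_bigr do rewrite /pulls_in natr_sum mulr_suml.
rewrite exchange_big /=; apply: eq_bigr => t _.
rewrite (bigD1 (arm_at pi u x t)) //= eqxx mul1r big1 ?addr0 // => i.
by rewrite eq_sym => /negPf ->; rewrite mul0r.
Qed.

(** In [n] rounds an arm is pulled at most [n] times, so no entry of index [n] or more is read. *)
Lemma eq_run_ltn x x' n : (forall i s, (s < n)%N -> x i s = x' i s) ->
  run pi u x n = run pi u x' n.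
Proof.
elim: n => //= n IH xx'; rewrite -IH => [|i s sn]; last by apply: xx'; rewrite ltnS ltnW.
congr (rcons _ (_, _)); apply: xx'.
by rewrite ltnS -[leqRHS](size_run x); exact: pulls_le_size.
Qed.

(** The runs can separate only by reading an entry of arm [j] of index at least [m]. At that round
    both counts have reached [m], and counts never decrease. *)
Lemma eq_run_or_saturated x x' n j m :
  (forall i s, (s < n)%N -> (i == j -> (s < m)%N) -> x i s = x' i s) ->
  run pi u x n = run pi u x' n \/
  (m <= pulls (run pi u x n) j)%N /\ (m <= pulls (run pi u x' n) j)%N.
Proof.
elim: n => [|n IH] xx' /=; first by left.
case: IH => [i s sn|<-|[mx mx']]; first by apply: xx'; rewrite ltnS ltnW.
- set h := run pi u x n; set a := pi u h.
  have ha : (pulls h a < n.+1)%N.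
    by rewrite ltnS -[leqRHS](size_run x); exact: pulls_le_size.
  have [aj|aj] := eqVneq a j; last by left; rewrite xx' // (negPf aj).
  have [hm|mh] := ltnP (pulls h a) m; first by left; rewrite xx'.
  by right; rewrite !pulls_rcons -aj eqxx (leq_trans mh) ?leq_addr.
- by right; rewrite !pulls_rcons !(leq_trans _ (leq_addr _ _)).
Qed.

(** Once the count of [j] has reached [m] it exceeds [k] for good, so the rewards of [j] after the
    first [m] cannot change the answer, even if they change the run. *)
Lemma pulls_gt_local x x' n j m k : (k < m)%N ->
  (forall i s, (s < n)%N -> (i == j -> (s < m)%N) -> x i s = x' i s) ->
  (k < pulls (run pi u x n) j)%N = (k < pulls (run pi u x' n) j)%N.
Proof.
move=> km /eq_run_or_saturated[->//|[mx mx']].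
by rewrite !(leq_trans km).
Qed.

Lemma sum_rewards_run x n i :
  \sum_(p <- run pi u x n | p.1 == i) p.2
  = \sum_(s < pulls (run pi u x n) i) x i s.
Proof.
elim: n => [|n IH] /=; first by rewrite big_nil big_ord0.
rewrite big_rcons /= pulls_rcons /= -/(arm_at pi u x n) IH.
case: eqP => [->|_]; last by rewrite addn0 Monoid.mulm1.
by rewrite addn1 big_ord_recr.
Qed.

Lemma emp_mean_run_le x n i (c : R) :
  (0 < pulls (run pi u x n) i)%N -> (forall s, x i s <= c) ->
  emp_mean (run pi u x n) i <= c.
Proof.
move=> N0 xc; rewrite /emp_mean sum_rewards_run ler_pdivrMr ?ltr0n//.
by rewrite mulr_natr -[in leRHS](card_ord (pulls _ _)) -sumr_const ler_sum.
Qed.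

Lemma emp_mean_run_cst x n i (c : R) :
  (0 < pulls (run pi u x n) i)%N -> (forall s, x i s = c) ->
  emp_mean (run pi u x n) i = c.
Proof.
move=> N0 xc; rewrite /emp_mean sum_rewards_run.
under eq_bigr do rewrite xc.
by rewrite sumr_const card_ord -[c *+ _]mulr_natr mulfK // pnatr_eq0 -lt0n.
Qed.

End run_theory.

(** * Measurability of the sequence of pulled arms *)

Section run_measurability.
Context {R : realType} {K : nat}.
Context {d : measure_display} {U : measurableType d} (pi : policy R K U).
Hypothesis mpi : measurable_policy pi.
Context {d' : measure_display} {Omega : measurableType d'}.
Context (seed : Omega -> U) (X : 'I_K -> nat -> Omega -> measurableTypeR R).
Hypothesis mseed : measurable_fun setT seed.
Hypothesis mX : forall i s, measurable_fun setT (X i s).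

Let hist w n := run pi (seed w) (table_at X w) n.

(* The table entries that are read when the arms a are pulled in this order. *)
Let coords (a : seq 'I_K) : seq ('I_K * nat) :=
  foldl (fun c i => rcons c (i, count_mem i (unzip1 c))) [::] a.

Let coords_rcons a i :
  coords (rcons a i) = rcons (coords a) (i, count_mem i (unzip1 (coords a))).
Proof. by rewrite /coords foldl_rcons. Qed.

Let unzip1_coords a : unzip1 (coords a) = a.
Proof.
by elim/last_ind: a => // a i IH; rewrite coords_rcons /unzip1 map_rcons -/(unzip1 _) IH.
Qed.

Let unzip1_histS n w :
  unzip1 (hist w n.+1) = rcons (unzip1 (hist w n)) (pi (seed w) (hist w n)).
Proof. by rewrite /unzip1 /hist /= map_rcons. Qed.

(** Once the arm sequence is fixed, the history reads a fixed finite list of reward variables. *)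
Let hist_coords n w :
  hist w n = [seq (p.1, X p.1 p.2 w) | p <- coords (unzip1 (hist w n))].
Proof.
elim: n => //= n IH; set h := hist w n in IH *.
rewrite -/h /unzip1 map_rcons coords_rcons map_rcons /=.
by rewrite -/(unzip1 _) -IH -/(unzip1 _) unzip1_coords pullsE.
Qed.

(** With the past arms frozen to [a], the observed rewards form a measurable vector, to which
    [measurable_policy] applies. *)
Let next_arm_measurable n (a : n.-tuple 'I_K) i :
  measurable [set w | pi (seed w) [seq (p.1, X p.1 p.2 w) | p <- coords a] = i].
Proof.
have szc : size (coords a) == n by rewrite -(size_map fst) -/(unzip1 _) unzip1_coords size_tuple.
pose r w : n.-tuple (measurableTypeR R) := [tuple of map (fun p => X p.1 p.2 w) (Tuple szc)].
have mr : measurable_fun setT r.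
  apply/measurable_fun_tnthP => t.
  apply: eq_measurable_fun (mX (tnth (Tuple szc) t).1 (tnth (Tuple szc) t).2) => w _.
  by rewrite /= tnth_map.
have := measurable_fun_pair mseed mr => /(_ measurableT _ (mpi a i)).
rewrite setTI; congr (measurable _); apply/seteqP.
suff E w : [seq (p.1, X p.1 p.2 w) | p <- coords a] = zip a (r w).
  by split => w /=; rewrite E.
rewrite /r /= -[X in zip X _]unzip1_coords /unzip1.
by elim: (coords a) => //= p c ->.
Qed.

Let arms_measurable n (a : seq 'I_K) : measurable [set w | unzip1 (hist w n) = a].
Proof.
elim: n a => [|n IH] a.
  case: a => [|i a].
    by rewrite [X in measurable X](_ : _ = setT) //; apply/seteqP; split.
  by rewrite [X in measurable X](_ : _ = set0) //; apply/seteqP; split.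
have [sza|sza] := eqVneq (size a) n.+1; last first.
  rewrite [X in measurable X](_ : _ = set0) //; apply/seteqP; split=> // w /= Ha.
  by move: sza; rewrite -Ha size_map (size_run _ _ _ n.+1) eqxx.
case/lastP: a sza => // a i; rewrite size_rcons => -[/eqP sza].
have := measurableI _ _ (IH a) (@next_arm_measurable n (Tuple sza) i).
congr (measurable _); apply/seteqP; split => w /=.
  move=> [Ha Hi]; rewrite unzip1_histS Ha; congr rcons.
  by rewrite -[RHS]Hi hist_coords Ha.
rewrite unzip1_histS => /rcons_inj[Ha Hi].
by split => //; rewrite -[RHS]Hi hist_coords Ha.
Qed.

(** An arm sequence of length [n] takes finitely many values, so every preimage is a finite union of
    measurable events, whatever [G] is. *)
Lemma measurable_fun_arms d3 (T : measurableType d3) (G : seq 'I_K -> T) n :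
  measurable_fun setT (fun w => G (unzip1 (run pi (seed w) (table_at X w) n))).
Proof.
move=> _ Y _; rewrite setTI.
rewrite [X in measurable X](_ : _ = \bigcup_(a in [set a : n.-tuple 'I_K | Y (G a)])
    [set w | unzip1 (hist w n) = a]); last first.
  apply/seteqP; split => w /=.
    have sz : size (unzip1 (hist w n)) == n by rewrite size_map size_run.
    by move=> YG; exists (Tuple sz).
  by case=> a /= Ya; rewrite /preimage /hist /= => ->.
by apply: fin_bigcup_measurable => // a _; exact: arms_measurable.
Qed.

Lemma measurable_arms (Q : seq 'I_K -> Prop) n :
  measurable [set w | Q (unzip1 (run pi (seed w) (table_at X w) n))].
Proof.
have := @measurable_fun_arms _ bool (fun a => `[< Q a >]) n.
move=> /(_ measurableT [set true] _); rewrite setTI.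
have -> // : [set w | Q (unzip1 (run pi (seed w) (table_at X w) n))] =
  (fun w => `[< Q (unzip1 (run pi (seed w) (table_at X w) n)) >]) @^-1` [set true].
  by apply/seteqP; split => w /=; [move/asboolP|move/asboolP].
exact.
Qed.

End run_measurability.

(** * Two-point laws and testing *)

Section two_point_laws.
Context {R : realType}.

Definition two_point_val (a : R) (v : bool) : measurableTypeR R := if v then a else 0.

Let measurable_two_point_val a : measurable_fun setT (two_point_val a).
Proof. by []. Qed.

HB.instance Definition _ a := isMeasurableFun.Build _ _ _ _ (two_point_val a)
  (@measurable_two_point_val a).

Definition two_point (p a : R) : probability (measurableTypeR R) R :=
  distribution (bernoulli_prob p) (two_point_val a).

Lemma two_pointE p a A : 0 <= p <= 1 ->
  two_point p a A = (p * \1_A a + (1 - p) * \1_A 0)%:E.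
Proof.
by move=> p01; rewrite /two_point /distribution /pushforward /= bernoulli_probE.
Qed.

Lemma mean_two_point p a : 0 <= p <= 1 -> 0 <= a ->
  \int[two_point p a]_x x = p * a.
Proof.
move=> p01 a0.
rewrite /Rintegral integral_distribution//.
- rewrite (integral_bernoulli_prob p01) => [|v]; last by case: v; rewrite /= lee_fin.
  by rewrite /= !mulr0 addr0.
- apply/integrableP; split => //.
  rewrite (integral_bernoulli_prob p01) => [|v]; last exact: abse_ge0.
  by rewrite -!EFinM -EFinD ltry.
Qed.

End two_point_laws.

(* Le Cam's two-point bound: the product weights factor as v1 z * q z and
   v2 z * q z with v1 z * v2 z constant, and the tangent-line inequality
   v1 >= v1 * v2 * (2 a - a^2 (v1 + v2)) sums over z in closed form. *)
Section testing.
Context {R : realFieldType} {J : finType} (S : pred J) (w1 w2 : J -> bool -> R).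
Context (kap : R) (phi : {ffun J -> bool} -> R).

Lemma product_testing_bound :
  (forall j v, 0 <= w1 j v) -> (forall j v, 0 <= w2 j v) ->
  (forall j, w1 j true + w1 j false = 1) -> (forall j, w2 j true + w2 j false = 1) ->
  (forall j v, S j -> w1 j v * w2 j v = kap) -> (forall j, ~~ S j -> w1 j = w2 j) ->
  (forall z, 0 <= phi z <= 1) ->
  (4 * kap) ^+ #|S| / 2
  <= \sum_z (phi z * \prod_j w1 j (z j) + (1 - phi z) * \prod_j w2 j (z j)).
Proof.
move=> w10 w20 s1 s2 w12 wS phi01.
pose q (z : {ffun J -> bool}) := \prod_(j | ~~ S j) w1 j (z j).
pose v1 (z : {ffun J -> bool}) := \prod_(j | S j) w1 j (z j).
pose v2 (z : {ffun J -> bool}) := \prod_(j | S j) w2 j (z j).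
have E1 (z : {ffun J -> bool}) : \prod_j w1 j (z j) = v1 z * q z by rewrite (bigID S).
have E2 (z : {ffun J -> bool}) : \prod_j w2 j (z j) = v2 z * q z.
  by rewrite (bigID S) /=; congr (_ * _); apply: eq_bigr => j /wS ->.
have Ev z : v1 z * v2 z = kap ^+ #|S|.
  rewrite -big_split /= (eq_bigr (fun=> kap)) ?prodr_const // => j Sj.
  exact: w12.
have v10 z : 0 <= v1 z by apply: prodr_ge0.
have v20 z : 0 <= v2 z by apply: prodr_ge0.
have q0 z : 0 <= q z by apply: prodr_ge0.
have sumb (F : J -> bool -> R) :
    \sum_(z : {ffun J -> bool}) \prod_j F j (z j) = \prod_j (F j true + F j false).
  by rewrite -bigA_distr_bigA /=; apply: eq_bigr => j _; rewrite big_bool.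
have S1 : \sum_z v1 z * q z = 1.
  transitivity (\sum_(z : {ffun J -> bool}) \prod_j w1 j (z j)).
    by apply: eq_bigr => z _; rewrite E1.
  by rewrite (sumb w1) big1.
have S2 : \sum_z v2 z * q z = 1.
  transitivity (\sum_(z : {ffun J -> bool}) \prod_j w2 j (z j)).
    by apply: eq_bigr => z _; rewrite E2.
  by rewrite (sumb w2) big1.
(* Coordinates in [S] do not enter [q], so each contributes 1 + 1, while the others sum to 1. *)
have Sq : \sum_z q z = 2 ^+ #|S|.
  pose F j v := if S j then 1 else w1 j v.
  transitivity (\sum_(z : {ffun J -> bool}) \prod_j F j (z j)).
    apply: eq_bigr => z _; rewrite /q [LHS]big_mkcond.
    by apply: eq_bigr => j _; rewrite /F; case: (S j).
  rewrite (sumb F) -prodr_const [RHS]big_mkcond /=; apply: eq_bigr => j _.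
  by rewrite /F unfold_in; case: (S j).
(* This [a] maximizes [2 * a * N - 2 * a ^+ 2], the total of the tangent bounds; the maximum is
   [N ^+ 2 / 2]. *)
set N : R := 2 ^+ #|S| in Sq; pose a := N / 2; set k := kap ^+ #|S| in Ev.
have -> : (4 * kap) ^+ #|S| / 2 = k * (2 * a * N - a ^+ 2 * (1 + 1)).
  have -> : (4 : R) = 2 * 2 by ring.
  by rewrite !exprMn -/N -/k /a; field.
have -> : k * (2 * a * N - a ^+ 2 * (1 + 1))
  = \sum_z k * (2 * a * q z - a ^+ 2 * (v1 z * q z + v2 z * q z)).
  by rewrite -mulr_sumr sumrB -!mulr_sumr big_split /= S1 S2 Sq.
apply: ler_sum => z _; rewrite E1 E2 -(Ev z).
(* The tangent to [1 / y] at [y = 1 / a] gives [1 / y >= 2 * a - a ^+ 2 * y]. The extra loss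
   [a ^+ 2 * x] makes the bound symmetric, so that it lies below both [v1 z] and [v2 z] and hence
   below their convex combination. *)
have tangent (x y : R) : 0 <= x -> 0 <= y -> x * y * (2 * a - a ^+ 2 * (x + y)) <= x.
  move=> x0 y0; rewrite -subr_ge0.
  have -> : x - x * y * (2 * a - a ^+ 2 * (x + y))
    = x * ((1 - a * y) ^+ 2 + a ^+ 2 * (x * y)) by ring.
  apply: mulr_ge0 => //; apply: addr_ge0; first exact: sqr_ge0.
  by apply: mulr_ge0; [exact: sqr_ge0|exact: mulr_ge0].
have /andP[p0 p1] := phi01 z.
have t1 := tangent _ _ (v10 z) (v20 z); have t2 := tangent _ _ (v20 z) (v10 z).
have -> : v1 z * v2 z * (2 * a * q z - a ^+ 2 * (v1 z * q z + v2 z * q z))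
  = (v1 z * v2 z * (2 * a - a ^+ 2 * (v1 z + v2 z))) * q z by ring.
have -> : phi z * (v1 z * q z) + (1 - phi z) * (v2 z * q z)
  = (phi z * v1 z + (1 - phi z) * v2 z) * q z by ring.
apply: ler_wpM2r => //; rewrite [v2 z * _]mulrC [v2 z + _]addrC in t2.
set x := _ * (2 * a - _) in t1 t2 *.
have -> : x = phi z * x + (1 - phi z) * x by ring.
by apply: lerD; apply: ler_wpM2l => //; rewrite subr_ge0.
Qed.

End testing.

(** * Finite rectangles and cells of rewards *)

Lemma sum_probability_le {R : realType} {d} {T : measurableType d} (P : probability T R)
    (Z : finType) (F : Z -> set T) (A : set T) :
  (forall z, measurable (F z)) -> trivIset setT F -> measurable A ->
  (forall z, F z `<=` A) -> \sum_z fine (P (F z)) <= fine (P A).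
Proof.
move=> mF tF mA FA; rewrite -lee_fin -sumEFin fineK ?fin_num_measure//.
under eq_bigr do rewrite fineK ?fin_num_measure//.
rewrite fsbig_seq ?index_enum_uniq//.
have -> : [set` index_enum Z] = setT by apply/seteqP; split => z //= _; exact: mem_index_enum.
rewrite -measure_fin_bigcup//; last exact: finite_finset.
rewrite le_measure ?inE//.
- by apply: fin_bigcup_measurable => //; exact: finite_finset.
- by move=> w [z _ /FA].
Qed.

(** The event is a finite rectangle, so its probability is a product of ones. It moves almost sure
    facts about single rewards to the whole table up to time [n]. *)
Lemma bandit_env_support {R : realType} {K : nat} {d} {U : measurableType d}
    (PU : probability U R) (nu : arm_laws R K) {d'} {Omega : measurableType d'}
    (P : probability Omega R) (seed : Omega -> U)
    (X : 'I_K -> nat -> Omega -> measurableTypeR R)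
    (n : nat) (S : 'I_K -> set (measurableTypeR R)) :
  bandit_env PU nu P seed X ->
  (forall i, measurable (S i)) -> (forall i, nu i (S i) = 1%E) ->
  let good := [set w | forall (i : 'I_K) (s : 'I_n), S i (X i s w)] in
  measurable good /\ P good = 1%E.
Proof.
move=> [mseed mX rect] mS nuS good; split.
  have -> : good = \bigcap_(j in [set: 'I_K * 'I_n]) (X j.1 j.2 @^-1` S j.1).
    apply/seteqP; split => w Xw; first by move=> [i s] _; exact: Xw.
    by move=> i s; exact: (Xw (i, s)).
  apply: fin_bigcap_measurable; first exact: finite_finset.
  by move=> j _; rewrite -[X in measurable X]setTI; exact: mX.
have -> : good = [set w | setT (seed w) /\ forall (i : 'I_K) (s : 'I_n), S i (X i s w)].
  by apply/seteqP; split => w /=; [|case].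
rewrite (rect n setT (fun i _ => S i)) // probability_setT mul1e.
by apply: big1 => i _; apply: big1 => s _.
Qed.

Section bandit_cells.
Context {R : realType} {K n : nat} (a : 'I_K -> R) (free : pred ('I_K * 'I_n)).
Hypothesis a0 : forall i, a i != 0.

(* A free coordinate is not observed. Giving it the whole space and the empty set
   as its two values keeps the cells disjoint and indexed by all z. *)
Definition cell_val (j : 'I_K * 'I_n) (v : bool) : set (measurableTypeR R) :=
  if free j then (if v then setT else set0) else [set two_point_val (a j.1) v].

Definition cell_weight (p : 'I_K -> R) (j : 'I_K * 'I_n) (v : bool) : R :=
  if free j then (if v then 1 else 0) else (if v then p j.1 else 1 - p j.1).

Lemma measurable_cell_val j v : measurable (cell_val j v).
Proof. by rewrite /cell_val; case: (free j); [case: v|exact: measurable_set1]. Qed.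

Lemma two_point_cell_val p j v : 0 <= p j.1 <= 1 ->
  two_point (p j.1) (a j.1) (cell_val j v) = (cell_weight p j v)%:E.
Proof.
move=> p01; rewrite two_pointE // /cell_val /cell_weight.
have [a0j a0j'] : (a j.1 == 0) = false /\ (0 == a j.1) = false.
  by rewrite [0 == _]eq_sym (negPf (a0 _)).
by case: (free j); case: v => /=; rewrite !indicE ?in_setT ?in_set0 ?in_set1
  ?a0j ?a0j' ?eqxx /= ?mulr0 ?mulr1 ?addr0 ?add0r ?subrKC.
Qed.

Lemma cell_val_inj j v v' x : cell_val j v x -> cell_val j v' x -> v = v'.
Proof.
rewrite /cell_val; case: (free j); first by case: v; case: v'.
by case: v; case: v' => //= -> /eqP; rewrite ?(negPf (a0 _)) // eq_sym (negPf (a0 _)).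
Qed.

Context {d : measure_display} {U : measurableType d} (PU : probability U R).
Context {d' : measure_display} {Omega : measurableType d'} (P : probability Omega R).
Context (seed : Omega -> U) (X : 'I_K -> nat -> Omega -> measurableTypeR R).
Context (p : 'I_K -> R).
Hypothesis p01 : forall i, 0 <= p i <= 1.
Hypothesis env : bandit_env PU (fun i => two_point (p i) (a i)) P seed X.

Let cell (D : set U) (z : {ffun 'I_K * 'I_n -> bool}) : set Omega :=
  [set w | D (seed w) /\
     forall (i : 'I_K) (s : 'I_n), cell_val (i, s) (z (i, s)) (X i s w)].

Let measurable_cell D z : measurable D -> measurable (cell D z).
Proof.
move=> mD; have [mseed mX _] := env.
have -> : cell D z = (seed @^-1` D) `&`
    \bigcap_(j in [set: 'I_K * 'I_n]) (X j.1 j.2 @^-1` cell_val j (z j)).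
  apply/seteqP; split => w [Dw Xw]; split => //.
    by move=> [i s] _; exact: Xw.
  by move=> i s; exact: (Xw (i, s)).
apply: measurableI; first by rewrite -[X in measurable X]setTI; exact: mseed.
apply: fin_bigcap_measurable => // j _.
by rewrite -[X in measurable X]setTI; apply: mX => //; exact: measurable_cell_val.
Qed.

Let probability_cell D z : measurable D ->
  P (cell D z) = (fine (PU D) * \prod_j cell_weight p j (z j))%:E.
Proof.
move=> mD; have [_ _ env_rect] := env.
rewrite (env_rect n D (fun i s => cell_val (i, s) (z (i, s))) mD); last first.
  by move=> i s; exact: measurable_cell_val.
rewrite EFinM fineK ?fin_num_measure//; congr (_ * _)%E.
rewrite -prodEFin.
transitivity (\prod_(i < K) \prod_(s < n) (cell_weight p (i, s) (z (i, s)))%:E)%E.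
  by apply: eq_bigr => i _; apply: eq_bigr => s _; exact: (@two_point_cell_val p (i, s)).
by rewrite pair_bigA /=; apply: eq_bigr => -[].
Qed.

(** The cells are disjoint parts of [A], and independence splits off the seed as [PU (D z)]. They
    need not cover [A]; an inequality is enough to bound error probabilities from below. *)
Lemma cells_le (D : {ffun 'I_K * 'I_n -> bool} -> set U) (A : set Omega) :
  (forall z, measurable (D z)) -> measurable A ->
  (forall z w, D z (seed w) ->
     (forall (i : 'I_K) (s : 'I_n), cell_val (i, s) (z (i, s)) (X i s w)) -> A w) ->
  \sum_z fine (PU (D z)) * \prod_j cell_weight p j (z j) <= fine (P A).
Proof.
move=> mD mA DA; apply: le_trans (@sum_probability_le _ _ _ P _
    (fun z => cell (D z) z) A _ _ _ _) => //.
- by apply: ler_sum => z _; rewrite probability_cell.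
- by move=> z; exact: measurable_cell.
- apply/trivIsetP => z z' _ _ /eqP zz'; apply/seteqP; split => // w [[_ Xz] [_ Xz']].
  apply: zz'; apply/ffunP => -[i s]; exact: cell_val_inj (Xz i s) (Xz' i s).
- by move=> z w [Dw Xw]; exact: DA Dw Xw.
Qed.

End bandit_cells.

(** * Testing the bias of one arm through an adaptive policy *)

Section bandit_testing.
Context {R : realType} {K : nat} (a p1 p2 : 'I_K -> R) (j0 : 'I_K).
Hypothesis a0 : forall i, a i != 0.
Hypothesis p1_01 : forall i, 0 <= p1 i <= 1.
Hypothesis p2_01 : forall i, 0 <= p2 i <= 1.
Hypothesis p12_j0 : p1 j0 + p2 j0 = 1.
Hypothesis p12 : forall i, i != j0 -> p1 i = p2 i.
Context {d : measure_display} {U : measurableType d} (PU : probability U R).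
Context (pi : policy R K U).
Hypothesis mpi : measurable_policy pi.
Context {d' : measure_display} {Omega : measurableType d'} (P1 P2 : probability Omega R).
Context (seed : Omega -> U) (X : 'I_K -> nat -> Omega -> measurableTypeR R).
Hypothesis env1 : bandit_env PU (fun i => two_point (p1 i) (a i)) P1 seed X.
Hypothesis env2 : bandit_env PU (fun i => two_point (p2 i) (a i)) P2 seed X.

(** A deterministic table that agrees with the rewards on the cell of [z], except possibly at free
    coordinates; the value 0 only fills indices from [n] on. *)
Let cell_table n (z : {ffun 'I_K * 'I_n -> bool}) : reward_table R K :=
  fun i s => if insub s is Some s' then two_point_val (a i) (z (i, s')) else 0.

(** On a cell the event depends on the seed alone. Both error probabilities then become sums over
    cells with the same randomized test [PU (D z)], which is the setting of
    [product_testing_bound]. *)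
Lemma bandit_testing_bound n m k : (k < m)%N ->
  (4 * (p1 j0 * p2 j0)) ^+ m / 2
  <= fine (P1 [set w | (k < pulls (run pi (seed w) (table_at X w) n) j0)%N])
   + fine (P2 (~` [set w | (k < pulls (run pi (seed w) (table_at X w) n) j0)%N])).
Proof.
move=> km; set A := [set w | _]; have [mseed mX _] := env1.
have mA : measurable A.
  have := measurable_arms mpi mseed mX (fun s => (k < count_mem j0 s)%N) n.
  by congr (measurable _); apply/seteqP; split => w /=; rewrite -pullsE.
(* Rewards of [j0] from index [m] on are left unobserved, so that the two laws differ only on the
   coordinates in [S]. *)
pose free (j : 'I_K * 'I_n) := (j.1 == j0) && (m <= j.2)%N.
pose S (j : 'I_K * 'I_n) := (j.1 == j0) && (j.2 < m)%N.
pose D (z : {ffun 'I_K * 'I_n -> bool}) : set U :=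
  [set u | (k < pulls (run pi u (cell_table z) n) j0)%N].
have mD z : measurable (D z).
  have := @measurable_arms R K d U pi mpi d U id (fun i s _ => cell_table z i s)
    (@measurable_id _ _ _) (fun i s => measurable_cst _) (fun s => (k < count_mem j0 s)%N) n.
  by congr (measurable _); apply/seteqP; split => w /=; rewrite -pullsE.
have cellE (z : {ffun 'I_K * 'I_n -> bool}) w :
    (forall (i : 'I_K) (s : 'I_n), cell_val a free (i, s) (z (i, s)) (X i s w)) ->
    D z (seed w) <-> A w.
  move=> Xw; rewrite /A /D /=.
  rewrite (@pulls_gt_local _ _ _ _ _ (table_at X w) (cell_table z) n j0 m k km)//.
  move=> i s sn im; have := Xw i (Ordinal sn); rewrite /cell_val /free /=.
  rewrite /table_at /cell_table insubT /= ifN ?negb_and -?ltnNge //.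
  by case: (i == j0) im => //= ->.
have le1 := @cells_le _ _ _ a free a0 _ _ PU _ _ P1 seed X p1 p1_01 env1 D A mD mA
  (fun z w Dw Xw => (cellE z w Xw).1 Dw).
have le2 := @cells_le _ _ _ a free a0 _ _ PU _ _ P2 seed X p2 p2_01 env2
  (fun z => ~` D z) (~` A) (fun z => measurableC (mD z)) (measurableC mA)
  (fun z w nDw Xw Aw => nDw ((cellE z w Xw).2 Aw)).
apply: le_trans (lerD le1 le2); rewrite -big_split /=.
(* Fewer than [m] coordinates remain when [n < m]; as the base is at most 1 ([kap_le1]), a smaller
   exponent only helps. *)
have Sm : (#|S| <= m)%N.
  rewrite -sum1_card big_mkcond /= -(pair_bigA _ (fun i s => if (i, s) \in S then 1 else 0)%N) /=.
  rewrite (bigD1 j0) //= [X in (_ + X)%N]big1 ?addn0; last first.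
    by move=> i ij; rewrite big1 // => s _; rewrite unfold_in /S /= (negPf ij).
  apply: (@leq_trans (\sum_(0 <= s < n | (s < m)%N) 1)%N).
    by rewrite big_mkord [leqRHS]big_mkcond leq_sum // => s _; rewrite unfold_in /S /= eqxx.
  rewrite sum1_count -size_filter -[leqRHS](size_iota 0).
  apply: uniq_leq_size; first by rewrite filter_uniq ?iota_uniq.
  by move=> s; rewrite mem_filter mem_iota => /andP[].
have q1 : 1 - p1 j0 = p2 j0 by rewrite -p12_j0; ring.
have q2 : 1 - p2 j0 = p1 j0 by rewrite -p12_j0; ring.
have kap_le1 : 4 * (p1 j0 * p2 j0) <= 1.
  rewrite -q1.
  by rewrite -subr_ge0; have := sqr_ge0 (1 - 2 * p1 j0); congr (_ <= _); ring.
have [/andP[p1_0 p1_1] /andP[p2_0 p2_1]] := (p1_01 j0, p2_01 j0).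
apply: (@le_trans _ _ ((4 * (p1 j0 * p2 j0)) ^+ #|S| / 2)).
  rewrite ler_pM2r ?invr_gt0//; apply: ler_wiXn2l => //.
  by rewrite mulr_ge0 ?mulr_ge0.
have w_ge0 (p : 'I_K -> R) j v : (forall i, 0 <= p i <= 1) -> 0 <= cell_weight free p j v.
  move=> p01; have /andP[? ?] := p01 j.1.
  by rewrite /cell_weight; case: (free j); case: v => //; rewrite subr_ge0.
have w_sum (p : 'I_K -> R) j : cell_weight free p j true + cell_weight free p j false = 1.
  by rewrite /cell_weight; case: (free j); rewrite ?addr0 // addrC subrK.
apply: le_trans (@product_testing_bound R _ S (cell_weight free p1) (cell_weight free p2)
  (p1 j0 * p2 j0) (fun z => fine (PU (D z))) _ _ _ _ _ _ _) _.
- by move=> j v; exact: w_ge0.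
- by move=> j v; exact: w_ge0.
- by move=> j; exact: w_sum.
- by move=> j; exact: w_sum.
- move=> [i s] v /andP[/= /eqP -> sm].
  rewrite /cell_weight /free /= eqxx leqNgt sm /=; case: v => //.
  by rewrite q1 q2 mulrC.
- move=> [i s] nS; rewrite /cell_weight /free /=; apply/funext => v.
  have [ij|ij] := eqVneq i j0; last by rewrite /= p12.
  by move: nS; rewrite /S ij /= ?eqxx -leqNgt => ->.
- move=> z; rewrite fine_ge0 ?measure_ge0 //= -[leRHS]/(fine 1%:E).
  by apply: fine_le; rewrite ?fin_num_measure// probability_le1.
- apply: ler_sum => z _; rewrite probability_setC // fineB ?fin_num_measure//.
Qed.

End bandit_testing.

(** * The hard instances *)

Section instance.
Context {B : nat}.
Implicit Types (b : 'I_B) (i : 'I_(2 * B + 1)).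

Fact known_arm_subproof b : (2 * b < 2 * B + 1)%N.
Proof. by have := ltn_ord b; lia. Qed.
Fact coin_arm_subproof b : (2 * b + 1 < 2 * B + 1)%N.
Proof. by have := ltn_ord b; lia. Qed.
Fact safe_arm_subproof : (2 * B < 2 * B + 1)%N.
Proof. by lia. Qed.

Definition known_arm b : 'I_(2 * B + 1) := Ordinal (known_arm_subproof b).
Definition coin_arm b : 'I_(2 * B + 1) := Ordinal (coin_arm_subproof b).
Definition safe_arm : 'I_(2 * B + 1) := Ordinal safe_arm_subproof.

Lemma sum_arms (V : nmodType) (F : 'I_(2 * B + 1) -> V) :
  \sum_i F i = \sum_b (F (known_arm b) + F (coin_arm b)) + F safe_arm.
Proof.
pose G k := if insub k is Some i then F i else 0.
have GE k (kK : (k < 2 * B + 1)%N) : G k = F (Ordinal kK) by rewrite /G insubT.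
transitivity (\sum_(i < 2 * B + 1) G i).
  by apply: eq_bigr => -[k kK] _; rewrite /= (GE k kK).
rewrite addn1 big_ord_recr /= (GE _ safe_arm_subproof); congr (_ + _).
transitivity (\sum_(b < B) (G (2 * b)%N + G (2 * b + 1)%N)).
  elim: B => [|n IH]; first by rewrite muln0 !big_ord0.
  by rewrite mulnS big_ord_recr big_ord_recr /= IH big_ord_recr /= -addrA addn1.
apply: eq_bigr => b _.
by rewrite (GE _ (known_arm_subproof b)) (GE _ (coin_arm_subproof b)).
Qed.

Definition block_group b : {set 'I_(2 * B + 1)} := [set known_arm b; coin_arm b].

(** The numbering is chosen for this: halving an index gives its block, and the safe arm gives [B],
    which is no block. *)
Lemma in_block_group i b : (i \in block_group b) = (i./2 == b).
Proof.
rewrite !inE -!val_eqE /=.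
by have := odd_double_half i; case: (odd i) => /=; lia.
Qed.

Lemma card_block_group b : #|block_group b| = 2%N.
Proof. by rewrite cards2 -val_eqE /=; case: eqP => //; lia. Qed.

Lemma block_group_inj : injective block_group.
Proof.
move=> b b' /setP/(_ (known_arm b)); rewrite !in_block_group /= mul2n doubleK eqxx.
by move=> /esym/eqP/val_inj.
Qed.

Lemma sum_block_group (V : nmodType) (F : 'I_(2 * B + 1) -> V) b :
  \sum_(i in block_group b) F i = F (known_arm b) + F (coin_arm b).
Proof. by rewrite big_setU1 ?inE ?big_set1 // -val_eqE /=; lia. Qed.

Definition hard_floors (H : nat) : floors (2 * B + 1) B :=
  Floors (fun=> H) [set block_group b | b : 'I_B]
    (fun b g => if g == block_group b then H./2 else 0%N).

Lemma block_group_in H b : block_group b \in groups (hard_floors H).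
Proof. exact: imset_f. Qed.

Lemma hard_groupsP H g :
  reflect (exists b, g = block_group b) (g \in groups (hard_floors H)).
Proof.
apply: (iffP imsetP) => [[b _ ->]|[b ->]]; by exists b.
Qed.

Lemma trivIset_hard_floors H : finset.trivIset (groups (hard_floors H)).
Proof.
apply/finset.trivIsetP => _ _ /hard_groupsP[b ->] /hard_groupsP[b' ->] bb'.
rewrite -setI_eq0; apply/eqP/setP => i; rewrite finset.in_set0 finset.in_setI !in_block_group.
apply: contraNF bb' => /andP[/eqP ib /eqP ib'].
by rewrite (_ : b = b') //; apply: val_inj; rewrite -[LHS]ib.
Qed.

Lemma arm_degree_hard_floors H : (0 < B)%N -> arm_degree (hard_floors H) = 1%N.
Proof.
move=> B0; apply/eqP; rewrite eqn_leq; apply/andP; split.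
  apply/bigmax_leqP => i _; apply/card_le1P.
  move=> _ /andP[/hard_groupsP[b ->]]; rewrite in_block_group => /eqP ib g.
  rewrite [LHS]inE [RHS]inE; apply/andP/eqP => [[/hard_groupsP[b' ->]]|->].
    by rewrite in_block_group ib => /eqP/val_inj ->.
  by rewrite block_group_in in_block_group ib.
apply: leq_trans (leq_bigmax (known_arm (Ordinal B0))).
apply/card_gt0P; exists (block_group (Ordinal B0)); apply/andP; split.
  exact: block_group_in.
by rewrite /= in_block_group.
Qed.

Lemma horizon_hard_floors H : horizon (hard_floors H) = (B * H)%N.
Proof. by rewrite /horizon /= sum_nat_const card_ord. Qed.

Lemma bstart_hard_floors H b : bstart (hard_floors H) b = (b * H)%N.
Proof.
rewrite /bstart /= -(big_ord_widen B (fun=> H)) ?(ltnW (ltn_ord b)) //.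
by rewrite sum_nat_const card_ord.
Qed.

Lemma bend_hard_floors H b : bend (hard_floors H) b = (b * H + H)%N.
Proof. by rewrite /bend bstart_hard_floors. Qed.

Lemma sum_blocks (V : nmodType) (F : nat -> V) H :
  \sum_(t < B * H) F t = \sum_(b < B) \sum_(b * H <= t < b * H + H) F t.
Proof.
elim: B => [|n IH]; first by rewrite mul0n !big_ord0.
rewrite big_ord_recr /= -IH -[LHS](big_mkord xpredT) -[X in X + _](big_mkord xpredT).
by rewrite -big_cat_nat ?leq_addr //= mulSn addnC.
Qed.

End instance.

Lemma sum_ltn_ord m n : (\sum_(k < m) (k < n) = minn n m)%N.
Proof.
elim: m => [|m IH]; first by rewrite big_ord0 minn0.
by rewrite big_ord_recr /= IH; lia.
Qed.

Lemma sum_geq_ord m n : (\sum_(k < m) (n <= k) = m - n)%N.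
Proof.
elim: m => [|m IH]; first by rewrite big_ord0.
by rewrite big_ord_recr /= IH; lia.
Qed.

(** * Reward laws indexed by sign vectors, and the regret decomposition *)

Section hard_family.
Context {R : realType} {B : nat} (e : R).
Hypothesis e_bounds : 0 <= e <= 2^-1.
Implicit Types (b : 'I_B) (i : 'I_(2 * B + 1)) (sg : {ffun 'I_B -> bool}).

Definition arm_value i : R :=
  if odd i then 2^-1 else if i == safe_arm then 1 else 4^-1.

(** Odd indices are the coin arms, and [insub] recovers their block after halving. Even arms pay
    with probability 1, so they are deterministic. The means in block [b] are thus 1/4 and 1/4 plus
    or minus [e / 2]. *)
Definition arm_prob sg i : R :=
  if odd i then 2^-1 + (if oapp sg false (insub i./2) then e else - e) else 1.

Definition hard_laws sg : arm_laws R (2 * B + 1) :=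
  fun i => two_point (arm_prob sg i) (arm_value i).

Lemma arm_value_known b : arm_value (known_arm b) = 4^-1.
Proof.
rewrite /arm_value /= mul2n odd_double ifN // -val_eqE /=.
by have := ltn_ord b; lia.
Qed.

Lemma arm_value_coin b : arm_value (coin_arm b) = 2^-1.
Proof. by rewrite /arm_value /= addn1 /= mul2n odd_double. Qed.

Lemma arm_value_safe : arm_value safe_arm = 1.
Proof. by rewrite /arm_value eqxx /= mul2n odd_double. Qed.

Lemma arm_value_neq0 i : arm_value i != 0.
Proof. by rewrite /arm_value; case: ifP => // _; case: ifP. Qed.

Lemma arm_value_bounds i : 0 <= arm_value i <= 1.
Proof. by rewrite /arm_value; case: ifP => _; [|case: ifP => _]; lra. Qed.

Lemma arm_value_le_half i : i != safe_arm -> arm_value i <= 2^-1.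
Proof. by rewrite /arm_value => /negPf ->; case: ifP => _; lra. Qed.

Lemma arm_prob_known sg b : arm_prob sg (known_arm b) = 1.
Proof. by rewrite /arm_prob /= mul2n odd_double. Qed.

Lemma arm_prob_coin sg b :
  arm_prob sg (coin_arm b) = 2^-1 + (if sg b then e else - e).
Proof. by rewrite /arm_prob /= addn1 /= mul2n odd_double /= uphalf_double valK. Qed.

Lemma arm_prob_safe sg : arm_prob sg safe_arm = 1.
Proof. by rewrite /arm_prob /= mul2n odd_double. Qed.

Lemma arm_prob_bounds sg i : 0 <= arm_prob sg i <= 1.
Proof.
move: e_bounds => /andP[? ?].
by rewrite /arm_prob; case: ifP => _; [case: ifP => _|]; apply/andP; split; lra.
Qed.

Lemma mean_hard_laws sg i : arm_mean (hard_laws sg) i = arm_prob sg i * arm_value i.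
Proof.
apply: mean_two_point; first exact: arm_prob_bounds.
by have /andP[] := arm_value_bounds i.
Qed.

Lemma mean_hard_laws_bounds sg i : 0 <= arm_mean (hard_laws sg) i <= 1.
Proof.
rewrite mean_hard_laws.
have [/andP[? ?] /andP[? ?]] := (arm_prob_bounds sg i, arm_value_bounds i).
by rewrite mulr_ge0 //= mulr_ile1.
Qed.

Lemma mean_hard_laws_safe sg : arm_mean (hard_laws sg) safe_arm = 1.
Proof. by rewrite mean_hard_laws arm_prob_safe arm_value_safe mulr1. Qed.

Lemma hard_laws_unit sg : unit_laws (hard_laws sg).
Proof.
move=> i; rewrite two_pointE; last exact: arm_prob_bounds.
have /andP[v0 v1] := arm_value_bounds i.
by rewrite !indicE !mem_set /= ?in_itv /= ?lexx ?ler01 ?v0 ?v1 // !mulr1 subrKC.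
Qed.

Lemma OPTfrac_hard_floors_ge H (mu : 'I_(2 * B + 1) -> R) (best : 'I_B -> 'I_(2 * B + 1)) :
  ~~ odd H -> (forall i, 0 <= mu i <= 1) -> mu safe_arm = 1 ->
  (forall b, best b \in block_group b) ->
  \sum_b (H./2)%:R * (1 + mu (best b)) <= OPTfrac (hard_floors H) mu.
Proof.
move=> evenH mu01 mu_safe in_best; apply: ler_sum => b _; set m : R := (H./2)%:R.
have m0 : 0 <= m by rewrite ler0n.
have mH : m + m = H%:R by rewrite -natrD addnn even_halfK.
(* The floor is met by one arm of the group, and the other half of the block goes to the safe
   arm. *)
pose y i := m * (i == safe_arm)%:R + m * (i == best b)%:R.
have sumy (F : 'I_(2 * B + 1) -> R) : \sum_i F i * y i = m * (F safe_arm + F (best b)).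
  have pick j : \sum_i F i * (m * (i == j)%:R) = F j * m.
    by rewrite (bigD1 j) //= eqxx mulr1 big1 ?addr0 // => i /negPf ->; rewrite !mulr0.
  under eq_bigr do rewrite mulrDr.
  by rewrite big_split /= !pick -mulrDl mulrC.
have y0 i : 0 <= y i by rewrite addr_ge0 ?mulr_ge0 ?ler0n.
apply: ub_le_sup; last first.
  exists y; last by rewrite sumy mu_safe.
  split => //.
  - move=> g /hard_groupsP[b' ->]; rewrite /= (inj_eq block_group_inj).
    case: eqP => [->|_]; last exact: sumr_ge0.
    rewrite (bigD1 (best b)) //= -[leLHS]addr0 lerD ?sumr_ge0 //.
    by rewrite /y eqxx mulr1 -[leLHS]add0r lerD2r mulr_ge0 ?ler0n.
  - under eq_bigr do rewrite -[y _]mul1r.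
    by rewrite (sumy (fun=> 1)) mulrDr mulr1.
(* A real [sup] dominates its set only if the set is bounded: means are at most 1 and allocations
   sum to [H]. *)
exists H%:R => _ [z [z0 _ zH] <-]; rewrite -[leRHS]zH; apply: ler_sum => i _.
by have /andP[_ ?] := mu01 i; rewrite ler_piMl.
Qed.

(* The group of block b gets at least m = H./2 pulls. If the coin arm gets n
   pulls, then at least m - n pulls (when sg b, i.e. the coin arm is better), resp.
   minn n m pulls, are suboptimal; wrong_pull is the k-th unit of this count. *)
Definition wrong_pull sg b (k : nat) (n : nat) : bool :=
  if sg b then (n <= k)%N else (k < n)%N.

(** The value is linear in the pull counts over the whole horizon. Eliminating the count of the safe
    arm through the total [B * H] splits the regret into one linear inequality per group, in which
    fairness enters only through [nm]. *)
Lemma policy_value_hard_floors_le {U : Type} H (pi : policy R (2 * B + 1) U) u x sg :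
  ~~ odd H -> group_fair (hard_floors H) pi -> in01 x ->
  policy_value (hard_floors H) (arm_mean (hard_laws sg)) pi u x
  + \sum_b \sum_(k < H./2)
      e / 2 * (wrong_pull sg b k (pulls (run pi u x (B * H)) (coin_arm b)))%:R
  <= OPTfrac (hard_floors H) (arm_mean (hard_laws sg)).
Proof.
move=> evenH fair x01; set mu := arm_mean _; set m := H./2.
have mH : (m + m = H)%N by rewrite addnn even_halfK.
pose best b := if sg b then coin_arm b else known_arm b.
apply: le_trans (@OPTfrac_hard_floors_ge H mu best evenH (mean_hard_laws_bounds sg)
  (mean_hard_laws_safe sg) _); last first.
  by move=> b; rewrite /best !inE; case: (sg b); rewrite eqxx ?orbT.
set n := fun i => pulls (run pi u x (B * H)) i.
have valE (F : 'I_(2 * B + 1) -> R) : \sum_(t < B * H) F (arm_at pi u x t)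
    = \sum_b ((n (known_arm b))%:R * F (known_arm b) + (n (coin_arm b))%:R * F (coin_arm b))
      + (n safe_arm)%:R * F safe_arm.
  rewrite -(big_mkord xpredT (fun t => F (arm_at pi u x t))) sum_pulls_in sum_arms.
  by rewrite /n !pulls_run; congr (_ + _); apply: eq_bigr => b _; rewrite !pulls_run.
have := valE (fun=> 1); rewrite sumr_const card_ord => total.
have safeE : (n safe_arm)%:R = (B * H)%:R
    - \sum_b ((n (known_arm b))%:R + (n (coin_arm b))%:R) :> R.
  rewrite total mulr1; under eq_bigr do rewrite !mulr1.
  by rewrite [X in _ = X - _]addrC addrK.
rewrite /policy_value horizon_hard_floors valE /mu mean_hard_laws_safe mulr1 safeE.
rewrite natrM -[B in B%:R * _]card_ord -sum1_card natr_sum mulr_suml -sumrB -!big_split /=.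
apply: ler_sum => b _; rewrite !mul1r -mulr_sumr -natr_sum.
(* Fairness in block [b] alone already forces [m] pulls of its group; pulls in other blocks can only
   add to the count. *)
have nm : (m <= n (known_arm b) + n (coin_arm b))%N.
  have := fair u x x01 b _ (block_group_in H b).
  rewrite /= eqxx sum_block_group => /leq_trans; apply.
  have sub i : (pulls_in pi u x (bstart (hard_floors H) b) (bend (hard_floors H) b) i <= n i)%N.
    rewrite /n pulls_run /pulls_in bend_hard_floors bstart_hard_floors.
    have bH : (b * H + H <= B * H)%N by rewrite -mulSnr leq_mul2r ltn_ord orbT.
    rewrite [leqRHS](big_cat_nat (n := b * H)) ?(leq_trans _ bH) ?leq_addr //=.
    by rewrite [X in (_ <= _ + X)%N](big_cat_nat (n := b * H + H)) ?leq_addr //= addnCA leq_addr.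
  by rewrite leq_add.
have sgE : (\sum_(k < m) wrong_pull sg b k (n (coin_arm b)) =
    if sg b then m - n (coin_arm b) else minn (n (coin_arm b)) m)%N.
  by rewrite /wrong_pull; case: (sg b); rewrite ?sum_geq_ord ?sum_ltn_ord.
rewrite sgE !mean_hard_laws /best arm_prob_known arm_prob_coin arm_value_known arm_value_coin.
rewrite -mH addnn doubleK -addnn natrD; move: (n _) (n _) nm => nB nA.
rewrite -(ler_nat R) natrD => nm.
move: e_bounds => /andP[e0 e1].
case sb: (sg b); rewrite ?arm_prob_coin ?arm_prob_known ?arm_value_known ?arm_value_coin ?sb /=.
  have [mB|Bm] := leqP m nB; last by rewrite natrB ?(ltnW Bm) //; lra.
  rewrite (eqP mB) mulr0; move: mB; rewrite -(ler_nat R) => mB.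
  (* Each coin pull beyond [m] loses [3 / 4 - e / 2] against the safe arm, even when the coin is the
     better arm of its group. *)
  have : 0 <= (3 / 4 - e / 2) * (nB%:R - m%:R) by apply: mulr_ge0; lra.
  by have : 0 <= nA%:R :> R by []; lra.
have [Bm|mB] := leqP nB m; first by lra.
have : 0 <= e * (nB%:R - m%:R) by rewrite mulr_ge0 // subr_ge0 ler_nat ltnW.
lra.
Qed.

End hard_family.

(** * The lower bound *)

Definition flip_at {I : finType} (b : I) (sg : {ffun I -> bool}) : {ffun I -> bool} :=
  [ffun i => (i == b) (+) sg i].

Lemma flip_atK {I : finType} (b : I) : involutive (flip_at b).
Proof. by move=> sg; apply/ffunP => i; rewrite !ffunE addbA addbb. Qed.

(** Flipping at [b] is an involution, so twice the sum of [g] is the sum over all pairs, and each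
    pair has one member with [sg b]. *)
Lemma sum_flip_ge {R : realFieldType} {I : finType} (b : I)
    (g : {ffun I -> bool} -> R) (tau : R) :
  (forall sg : {ffun I -> bool}, sg b -> tau <= g sg + g (flip_at b sg)) ->
  tau / 2 *+ #|{ffun I -> bool}| <= \sum_sg g sg.
Proof.
move=> g_ge; have pair_ge (sg : {ffun I -> bool}) : tau <= g sg + g (flip_at b sg).
  have [/g_ge //|sgb] := boolP (sg b).
  rewrite addrC -{2}[sg](flip_atK b) g_ge //.
  by rewrite ffunE eqxx addTb.
have : \sum_(sg : {ffun I -> bool}) tau <= \sum_sg (g sg + g (flip_at b sg)).
  by apply: ler_sum => sg _; exact: pair_ge.
have flipE : \sum_sg g (flip_at b sg) = \sum_sg g sg.
  by rewrite [RHS](reindex_inj (inv_inj (flip_atK b))).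
rewrite sumr_const big_split /= flipE -mulrnAl.
lra.
Qed.

Section lower_bound.
Context {R : realType} {B H : nat} (e : R).
Hypothesis e_bounds : 0 <= e <= 2^-1.
Context {d : measure_display} {U : measurableType d} (PU : probability U R).
Context (pi : policy R (2 * B + 1) U).
Hypothesis mpi : measurable_policy pi.
Context {d' : measure_display} {Omega : measurableType d'}.
Context (P : arm_laws R (2 * B + 1) -> probability Omega R).
Context (seed : Omega -> U) (X : 'I_(2 * B + 1) -> nat -> Omega -> measurableTypeR R).
Implicit Type sg : {ffun 'I_B -> bool}.
Hypothesis env : forall sg, bandit_env PU (hard_laws e sg) (P (hard_laws e sg)) seed X.

Let m := H./2.
Let coin_pulls (b : 'I_B) w := pulls (run pi (seed w) (table_at X w) (B * H)) (coin_arm b).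
Let wrong_event sg b k : set Omega := [set w | wrong_pull sg b k (coin_pulls b w)].
Let V sg w := policy_value (hard_floors H) (arm_mean (hard_laws e sg)) pi (seed w) (table_at X w).
Let gap sg : R := \sum_b \sum_(k < m) e / 2 * fine (P (hard_laws e sg) (wrong_event sg b k)).

Let measurable_wrong_event sg b k : measurable (wrong_event sg b k).
Proof.
have [mseed mX _] := env sg.
have := measurable_arms mpi mseed mX
  (fun s => wrong_pull sg b k (count_mem (coin_arm b) s)) (B * H)%N.
by congr (measurable _); apply/seteqP; split => w /=; rewrite /wrong_event /coin_pulls /= pullsE.
Qed.

(** An average over all sign vectors is bounded. After exchanging sums, [b] and [k] are fixed, and
    [sg] is paired with its flip at [b]: the two laws differ only at the coin arm of [b], where the
    wrong events are complementary. *)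
Lemma exists_gap_ge : exists sg,
  e / 2 * ((1 - 4 * e ^+ 2) ^+ m / 4) * (B * m)%:R <= gap sg.
Proof.
have [/andP[e0 e1]] := e_bounds; set tau := _ ^+ m / 4.
apply: contrapT => /forallNP gap_lt.
have : \sum_sg gap sg < \sum_(sg : {ffun 'I_B -> bool}) e / 2 * tau * (B * m)%:R.
  apply: ltr_sum; last by move=> sg _; rewrite ltNge; apply/negP/gap_lt.
  by apply/hasP; exists [ffun=> true] => //; exact: mem_index_enum.
apply/negP; rewrite -leNgt sumr_const exchange_big /=.
have -> : e / 2 * tau * (B * m)%:R *+ #|{ffun 'I_B -> bool}|
  = \sum_(b < B) \sum_(k < m) e / 2 * (tau *+ #|{ffun 'I_B -> bool}|).
  rewrite !sumr_const !card_ord -!mulrnA -[RHS]mulr_natr -[LHS]mulr_natr -[tau *+ _]mulr_natr.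
  by rewrite !natrM; ring.
apply: ler_sum => b _; rewrite exchange_big /=; apply: ler_sum => k _.
rewrite -mulr_sumr ler_wpM2l ?divr_ge0 //.
(* One half comes from the testing bound, the other from the pairing. *)
have -> : tau = (1 - 4 * e ^+ 2) ^+ m / 2 / 2 by rewrite /tau; field.
apply: (sum_flip_ge (b := b)) => sg sgb; rewrite [leRHS]addrC.
pose sg' := flip_at b sg; have sg'b : sg' b = false by rewrite ffunE eqxx sgb.
have coin_neq (i : 'I_(2 * B + 1)) : i != coin_arm b ->
    arm_prob e sg' i = arm_prob e sg i.
  move=> ib; rewrite /arm_prob; case: ifP => // oi; congr (_ + _).
  case: insubP => //= b' _ b'E; rewrite ffunE; case: eqP => // b'b.
  move: ib; rewrite -val_eqE /= -b'b b'E => /eqP[].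
  by have := odd_double_half i; rewrite oi; lia.
have -> : 1 - 4 * e ^+ 2 = 4 * (arm_prob e sg' (coin_arm b) * arm_prob e sg (coin_arm b)).
  by rewrite !arm_prob_coin sgb sg'b; field.
have coin_sum : arm_prob e sg' (coin_arm b) + arm_prob e sg (coin_arm b) = 1.
  by rewrite !arm_prob_coin sgb sg'b; field.
have -> : wrong_event sg' b k = [set w | (k < coin_pulls b w)%N].
  apply/seteqP; split => w; rewrite /wrong_event /wrong_pull /= sg'b; exact: id.
have -> : wrong_event sg b k = ~` [set w | (k < coin_pulls b w)%N].
  apply/seteqP; split => w; rewrite /wrong_event /wrong_pull /= sgb.
    by rewrite leqNgt => /negP; exact.
  by move=> /negP; rewrite -leqNgt; exact.
have := bandit_testing_bound (@arm_value_neq0 R B) (arm_prob_bounds e_bounds sg')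
  (arm_prob_bounds e_bounds sg) coin_sum coin_neq mpi (env sg') (env sg) (B * H) (ltn_ord k).
exact.
Qed.

Hypothesis evenH : ~~ odd H.
Hypothesis fair : group_fair (hard_floors H) pi.

Let measurable_V sg : measurable_fun setT (V sg).
Proof.
have [mseed mX _] := env sg.
apply: eq_measurable_fun (measurable_fun_arms mpi mseed mX
  (fun s => \sum_(i <- s) arm_mean (hard_laws e sg) i : measurableTypeR R) (B * H)%N) => w _.
by rewrite /V /policy_value horizon_hard_floors sum_arm_at.
Qed.

Let V_ge0 sg w : 0 <= V sg w.
Proof.
apply: sumr_ge0 => t _.
by have /andP[] := mean_hard_laws_bounds e_bounds sg (arm_at pi (seed w) (table_at X w) t).
Qed.

(* The hypothesis group_fair only concerns tables with entries in [0, 1]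
   everywhere, hence the truncation of the table after the horizon. *)
Let almost_surely_V_le sg :
  {ae P (hard_laws e sg), forall w, V sg w + \sum_b \sum_(k < m) e / 2 * \1_(wrong_event sg b k) w
     <= OPTfrac (hard_floors H) (arm_mean (hard_laws e sg))}.
Proof.
pose I01 : set (measurableTypeR R) := `[0, 1]%classic.
have [mgood Pgood] := bandit_env_support (B * H) (S := fun=> I01) (env sg)
  (fun=> measurable_itv _) (hard_laws_unit e_bounds sg).
set good := [set w | _] in mgood Pgood.
exists (~` good); split; first exact: measurableC.
  by rewrite probability_setC // Pgood subee.
move=> w /=; apply: contra_not => Xw.
pose x : reward_table R (2 * B + 1) := fun i s => if (s < B * H)%N then X i s w else 0.
have x01 : in01 x.
  move=> i s; rewrite /x; case: ltnP => [sT|_]; last by rewrite lexx ler01.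
  by have := Xw i (Ordinal sT); rewrite /I01 /= in_itv.
have runE n : (n <= B * H)%N -> run pi (seed w) (table_at X w) n = run pi (seed w) x n.
  move=> nT; apply: eq_run_ltn => i s sn.
  by rewrite /x /table_at (leq_trans sn nT).
have := policy_value_hard_floors_le e_bounds (seed w) sg evenH fair x01.
congr (_ + _ <= _).
  rewrite /V /policy_value horizon_hard_floors; apply: eq_bigr => t _.
  by rewrite /arm_at runE // ltnW.
apply: eq_bigr => b _; apply: eq_bigr => k _; congr (_ * _).
by rewrite indicE /coin_pulls -runE // mem_setE.
Qed.

Lemma expected_regret_ge sg :
  ((gap sg)%:E <= (OPTfrac (hard_floors H) (arm_mean (hard_laws e sg)))%:E
    - 'E_(P (hard_laws e sg)) [V sg])%E.
Proof.
set Q := P (hard_laws e sg); set opt := OPTfrac _ _.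
have e2 : 0 <= e / 2 by move: e_bounds => /andP[? _]; rewrite divr_ge0.
pose W w : R := \sum_b \sum_(k < m) e / 2 * \1_(wrong_event sg b k) w.
have mW : measurable_fun setT W.
  apply: measurable_sum => b; apply: measurable_sum => k.
  by apply: measurable_funM => //; exact: measurable_indic.
have W0 w : 0 <= W w by do 2 (apply: sumr_ge0 => ? _); rewrite mulr_ge0.
(* Monotonicity of the expectation is applied to nonnegative functions, one of which is the constant
   [opt]. *)
have opt0 : 0 <= opt.
  apply: le_trans (@OPTfrac_hard_floors_ge R B H _ (@known_arm B) evenH
    (mean_hard_laws_bounds e_bounds sg) (mean_hard_laws_safe e_bounds sg) _).
    apply: sumr_ge0 => b _; rewrite mulr_ge0 // addr_ge0 //.
    by have /andP[] := mean_hard_laws_bounds e_bounds sg (known_arm b).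
  by move=> b; rewrite !inE eqxx.
have le_opt : ('E_Q[(V sg \+ W)%R] <= opt%:E)%E.
  rewrite -(expectation_cst Q); apply: expectation_le => //.
  - exact: measurable_funD.
  - by move=> w; rewrite addr_ge0.
  - exact: almost_surely_V_le.
have EW : (\int[Q]_w (W w)%:E = (gap sg)%:E)%E.
  under eq_integral do rewrite /W pair_bigA /= -sumEFin.
  rewrite ge0_integral_sum //.
  - rewrite /gap pair_bigA /= -sumEFin; apply: eq_bigr => -[b k] _ /=.
    under eq_integral do rewrite EFinM.
    rewrite ge0_integralZl //; last by apply/measurable_EFinP; exact: measurable_indic.
    by rewrite integral_indic // setIT [RHS]EFinM fineK ?fin_num_measure.
  - by move=> j; apply/measurable_EFinP; exact: measurable_funM.
  - by move=> j w _; rewrite lee_fin mulr_ge0.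
have ED : ('E_Q[(V sg \+ W)%R] = 'E_Q[V sg] + (gap sg)%:E)%E.
  rewrite unlock -EW -ge0_integralD //.
  - by move=> w _; rewrite lee_fin.
  - exact/measurable_EFinP.
  - by move=> w _; rewrite lee_fin.
  - exact/measurable_EFinP.
have EV0 : (0 <= 'E_Q[V sg])%E by exact: expectation_ge0.
(* [EV0] excludes minus infinity and [le_opt] excludes plus infinity, so the subtraction takes place
   in the reals. *)
move: le_opt; rewrite ED; case: ('E_Q[V sg])%E EV0 => // v _.
by rewrite -EFinD -EFinB !lee_fin lerBrDl.
Qed.

End lower_bound.

(** * The upper bound *)

Section upper_bound.
Context {R : realType} {B H : nat} (L : R) (n : 'I_B -> 'I_(2 * B + 1) -> nat).
Context {U : Type} (pi : policy R (2 * B + 1) U) (u : U) (x : reward_table R (2 * B + 1)).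
Hypothesis ucb : group_bdq_ucb (hard_floors H) n L pi.
Hypothesis L_ge : 2^-1 <= L.
Hypothesis mandatory_le : forall b, (mandatory n b <= H)%N.
Hypothesis x01 : in01 x.
Hypothesis x_safe : forall s, x safe_arm s = 1.
Hypothesis x_half : forall i s, i != safe_arm -> x i s <= 2^-1.

Let is_residual t := [exists b : 'I_B, (b * H + mandatory n b <= t < b * H + H)%N].

Let is_residualE (b : 'I_B) t : (b * H <= t < b * H + H)%N ->
  is_residual t = (b * H + mandatory n b <= t)%N.
Proof.
move=> /andP[bt tb]; apply/existsP/idP => [[b' /andP[b't tb']]|bt']; last first.
  by exists b; rewrite bt' tb.
have divE (c : 'I_B) : (c * H <= t)%N -> (t < c * H + H)%N -> (t %/ H)%N = c.
  move=> ct tc; rewrite -(subnKC ct) divnMDl; last by lia.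
  by rewrite divn_small ?addn0 //; lia.
suff -> : b = b' by [].
by apply: val_inj; rewrite /= -(divE b) // (divE b') // (leq_trans (leq_addr _ _) b't).
Qed.

(** An observed safe arm has empirical mean exactly 1, hence index at least 1. An observed unsafe
    arm has empirical mean at most 1/2, so to be chosen it needs a bonus of at least 1/2, that is
    [2 * L / N >= 1 / 4]. *)
Let residual_arm_pulls t : is_residual t -> arm_at pi u x t != safe_arm ->
  (pulls (run pi u x t) (arm_at pi u x t))%:R <= 8 * L.
Proof.
set i := arm_at pi u x t => /existsP[b bt] i_unsafe.
have [_ /(_ t)] := ucb u x01 b.
rewrite bend_hard_floors bstart_hard_floors => /(_ bt safe_arm).
rewrite -/i /ucb_index; have [->|Ni] := eqVneq (pulls (run pi u x t) i) 0%N.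
  by move=> _; have := L_ge; rewrite mulr0n; lra.
(* If the safe arm is unobserved, its index [+oo] beats the finite index of an observed arm. *)
case: eqP => // /eqP Ns; rewrite lee_fin.
rewrite -!lt0n in Ni Ns.
rewrite (emp_mean_run_cst Ns x_safe).
have := emp_mean_run_le Ni (fun s => x_half s i_unsafe).
set y := Num.sqrt (2 * L / (pulls _ i)%:R) => mi index_le.
have Ni0 : 0 < (pulls (run pi u x t) i)%:R :> R by rewrite ltr0n.
have y_ge : 2^-1 <= y.
  by have := sqrtr_ge0 (2 * L / (pulls (run pi u x t) safe_arm)%:R); lra.
have : 2^-1 ^+ 2 <= y ^+ 2 by rewrite ler_pXn2r ?nnegrE ?sqrtr_ge0 ?invr_ge0.
rewrite sqr_sqrtr; last first.
  by rewrite divr_ge0 ?ler0n // mulr_ge0 // (le_trans _ L_ge).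
by rewrite ler_pdivlMr //; lra.
Qed.

Let residual_pulls_le i t : i != safe_arm ->
  (\sum_(t' < t) (is_residual t' && (arm_at pi u x t' == i)))%:R <= 8 * L + 1.
Proof.
move=> i_unsafe.
(* The induction also carries the comparison with all pulls of [i]: before a further residual pull
   the count is then at most [8 * L], and that pull adds the 1. *)
suff : (\sum_(t' < t) (is_residual t' && (arm_at pi u x t' == i))
        <= pulls (run pi u x t) i)%N /\
  (\sum_(t' < t) (is_residual t' && (arm_at pi u x t' == i)))%:R <= 8 * L + 1 by case.
elim: t => [|t [IH1 IH2]]; first by rewrite big_ord0; split => //;
  have := L_ge; rewrite mulr0n; lra.
rewrite big_ord_recr /= pulls_rcons -/(arm_at pi u x t).
case: eqP => [ti|_]; last by rewrite andbF !addn0.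
case: (boolP (is_residual t)) => res_t /=; last first.
  by rewrite addn0; split => //; exact: leq_trans IH1 (leq_addr _ _).
split; first by rewrite leq_add2r.
have := residual_arm_pulls res_t; rewrite ti => /(_ i_unsafe).
by move: IH1; rewrite natrD -(ler_nat R); lra.
Qed.

Let sum_residual (F : nat -> R) :
  \sum_(t < B * H) (is_residual t)%:R * F t
  = \sum_(b < B) \sum_(b * H + mandatory n b <= t < b * H + H) F t.
Proof.
rewrite (sum_blocks (fun t => (is_residual t)%:R * F t)); apply: eq_bigr => b _.
rewrite (big_cat_nat (n := b * H + mandatory n b)) ?leq_addr ?leq_add2l //=.
rewrite big_nat big1 ?add0r => [|t /andP[bt tb]].
  apply: eq_big_nat => t /andP[bt tb].
  by rewrite (is_residualE (b := b)) ?bt ?mul1r // tb (leq_trans (leq_addr _ _) bt).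
have tH : (t < b * H + H)%N by rewrite (leq_trans tb) // leq_add2l.
by rewrite (is_residualE (b := b)) ?bt // leqNgt tb mul0r.
Qed.

(** The mandatory pulls cancel against the comparator. What remains is at most [Q], the number of
    residual pulls of unsafe arms, since each loses at most 1. *)
Lemma plan_regret_le (mu : 'I_(2 * B + 1) -> R) :
  (forall i, 0 <= mu i <= 1) -> mu safe_arm = 1 ->
  plan_regret (hard_floors H) n mu pi u x
  <= 4 * Num.sqrt ((2 * B + 1)%:R * (residual (hard_floors H) n)%:R * L).
Proof.
move=> mu01 mu_safe; set Res := residual _ _.
pose Q : R := \sum_(t < B * H) (is_residual t)%:R * (arm_at pi u x t != safe_arm)%:R.
have ResE : Res%:R = \sum_(t < B * H) (is_residual t)%:R * 1 :> R.
  rewrite (sum_residual (fun=> 1)) /Res /residual natr_sum; apply: eq_bigr => b _.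
  by rewrite sumr_const_nat subnDl.
have Q_le_Res : Q <= Res%:R.
  by rewrite ResE; apply: ler_sum => t _; rewrite ler_wpM2l // lern1 leq_b1.
have Q_le_KL : Q <= (2 * B + 1)%:R * (8 * L + 1).
  have -> : Q = \sum_(i | i != safe_arm)
      (\sum_(t < B * H) (is_residual t && (arm_at pi u x t == i)))%:R.
    under [RHS]eq_bigr do rewrite natr_sum.
    rewrite exchange_big /=; apply: eq_bigr => t _.
    case: (is_residual t); last by rewrite mul0r big1.
    rewrite mul1r /=; case: eqP => [->|/eqP A_unsafe].
      by rewrite big1 // => i; rewrite eq_sym => /negPf ->.
    by rewrite (bigD1 (arm_at pi u x t)) //= eqxx big1 ?addr0 // => i /andP[_];
      rewrite eq_sym => /negPf ->.
  apply: le_trans (ler_sum _ (fun i => @residual_pulls_le i _)) _.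
  rewrite sumr_const -[leLHS]mulr_natl; apply: ler_wpM2r; first by have := L_ge; lra.
  by rewrite ler_nat; apply: leq_trans (max_card _) _; rewrite card_ord.
have regret_le : plan_regret (hard_floors H) n mu pi u x <= Q.
  have sup_le : sup (range mu) <= 1.
    apply: ge_sup; first by exists (mu safe_arm), safe_arm.
    by move=> _ [i _ <-]; have /andP[] := mu01 i.
  have VE : policy_value (hard_floors H) mu pi u x
      = \sum_(b < B) \sum_i (n b i)%:R * mu i
        + \sum_(t < B * H) (is_residual t)%:R * mu (arm_at pi u x t).
    rewrite /policy_value horizon_hard_floors (sum_residual (fun t => mu (arm_at pi u x t))).
    rewrite (sum_blocks (fun t => mu (arm_at pi u x t))) -big_split; apply: eq_bigr => b _ /=.
    rewrite (big_cat_nat (n := b * H + mandatory n b)) ?leq_addr ?leq_add2l //=.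
    congr (_ + _); rewrite sum_pulls_in; apply: eq_bigr => i _; congr (_%:R * _).
    by have [+ _] := ucb u x01 b; rewrite bstart_hard_floors => /(_ i).
  rewrite /plan_regret /comparator_value VE opprD addrACA subrr add0r.
  apply: (@le_trans _ _ (Res%:R * 1 - \sum_(t < B * H) (is_residual t)%:R * mu (arm_at pi u x t))).
    by rewrite lerD2r ler_wpM2l.
  rewrite mulr1 ResE -sumrB; apply: ler_sum => t _; rewrite -mulrBr ler_wpM2l //.
  case: eqP => [->|_]; first by rewrite mu_safe subrr.
  by have /andP[? ?] := mu01 (arm_at pi u x t); rewrite lerBlDr lerDl.
apply: le_trans regret_le _.
have Q0 : 0 <= Q by apply: sumr_ge0 => t _; rewrite mulr_ge0.
set K : R := (2 * B + 1)%:R in Q_le_KL *.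
have K0 : 0 <= K by rewrite ler0n.
have KRL0 : 0 <= K * Res%:R * L by rewrite !mulr_ge0 ?ler0n // (le_trans _ L_ge).
rewrite -(@ler_pXn2r _ 2) ?nnegrE ?mulr_ge0 ?sqrtr_ge0 //.
rewrite exprMn sqr_sqrtr // expr2.
apply: (@le_trans _ _ (Res%:R * (K * (8 * L + 1)))).
  by apply: ler_pM.
(* It remains that [8 * L + 1 <= 16 * L], which follows from [L_ge]. *)
have -> : 4 ^+ 2 * (K * Res%:R * L) = Res%:R * (K * (16 * L)) by ring.
apply: ler_wpM2l => //; apply: ler_wpM2l => //; have := L_ge; lra.
Qed.

End upper_bound.

(** * Choice of the bias, and existence of a plan *)

Section plans.
Context {R : realType} {B H : nat}.

(** Bernoulli's inequality. *)
Lemma ler1Bn_expr (a : R) m : 0 <= a <= 1 -> 1 - m%:R * a <= (1 - a) ^+ m.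
Proof.
move=> /andP[a0 a1]; elim: m => [|m IH]; first by rewrite mul0r subr0 expr0.
rewrite exprS; apply: le_trans (ler_wpM2l _ IH); last by rewrite subr_ge0.
rewrite -natr1 -subr_ge0.
have -> : (1 - a) * (1 - m%:R * a) - (1 - (m%:R + 1) * a) = m%:R * a ^+ 2 by ring.
by rewrite mulr_ge0 ?sqr_ge0.
Qed.

(** This bias gives [4 * e ^+ 2 * m = 1 / 4], so the affinity term stays above 3/4 while [e * m] is
    a quarter of [s]. The constant 1/100 comes from [2 / 100 <= 3 / 128]. *)
Lemma le_gap_rate (e : R) : (2 <= H)%N -> ~~ odd H ->
  e = (4 * Num.sqrt (H./2)%:R)^-1 ->
  0 <= e <= 2^-1 /\
  100^-1 * B%:R * Num.sqrt H%:R
  <= e / 2 * ((1 - 4 * e ^+ 2) ^+ H./2 / 4) * (B * H./2)%:R.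
Proof.
move=> H2 evenH; set m := H./2.
have mH : (m + m = H)%N by rewrite addnn even_halfK.
have m_gt0 : 1 <= m%:R :> R by rewrite ler1n; lia.
set s := Num.sqrt m%:R => eE.
have s1 : 1 <= s by rewrite -sqrtr1 ler_sqrt.
have ss : s ^+ 2 = m%:R by rewrite sqr_sqrtr.
have s0 : s != 0 by rewrite gt_eqF // (lt_le_trans ltr01).
have natH : H%:R = m%:R + m%:R :> R by rewrite -mH natrD.
clear mH.
have es : e * s = 4^-1 by rewrite eE; field.
have e0 : 0 < e by rewrite eE invr_gt0; lra.
have e4 : e <= 4^-1 by nra.
split; first by apply/andP; split; lra.
have rate : 3 / 4 <= (1 - 4 * e ^+ 2) ^+ m.
  apply: le_trans (@ler1Bn_expr (4 * e ^+ 2) m _); last by apply/andP; split; nra.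
  rewrite -ss (_ : s ^+ 2 * _ = 4 * (e * s) ^+ 2); last by ring.
  by rewrite es; lra.
have sqrtH : Num.sqrt H%:R <= 2 * s.
  rewrite -[leRHS]ger0_norm; last by lra.
  rewrite -sqrtr_sqr ler_sqrt ?sqr_ge0 // exprMn ss natH; lra.
rewrite natrM -ss.
have -> : e / 2 * ((1 - 4 * e ^+ 2) ^+ m / 4) * (B%:R * s ^+ 2)
  = B%:R * (e * s * s * (1 - 4 * e ^+ 2) ^+ m / 8) by field.
rewrite es [100^-1 * _]mulrC -[leLHS]mulrA; apply: ler_wpM2l => //.
have : s * (3 / 4) <= s * (1 - 4 * e ^+ 2) ^+ m by apply: ler_wpM2l => //; lra.
lra.
Qed.

Lemma rounding_mandatory_le (x : 'I_B -> 'I_(2 * B + 1) -> R) n b :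
  fractional_plan (hard_floors H) x -> rounding (hard_floors H) x n ->
  (mandatory n b <= H)%N.
Proof.
move=> /(_ b)[_ _ ceil_le] /(_ b)[n_eq _].
rewrite -lez_nat; apply: le_trans ceil_le; rewrite /mandatory.
rewrite (big_morph Posz PoszD (erefl _)); apply: ler_sum => i _.
case: (n_eq i) => -> //; rewrite -(ler_int R).
exact: le_trans (floor_le _) (ceil_ge _).
Qed.

Lemma exists_fractional_plan : (2 <= H)%N -> ~~ odd H -> (0 < B)%N ->
  exists (x : 'I_B -> 'I_(2 * B + 1) -> R) (n : 'I_B -> 'I_(2 * B + 1) -> nat),
    fractional_plan (hard_floors H) x /\ rounding (hard_floors H) x n.
Proof.
move=> H2 evenH B0.
have mH : (H./2 + H./2 = H)%N by rewrite addnn even_halfK.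
(* The floor plus the arm degree 1, all on the known arm. The plan is integral, hence its own
   rounding, and [H./2 + 1 <= H] because [2 <= H]. *)
pose n (b : 'I_B) (i : 'I_(2 * B + 1)) := if i == known_arm b then (H./2).+1 else 0%N.
have ceiln k : Num.ceil (k%:R : R) = k%:Z by rewrite [k%:R]pmulrn intrKceil.
have sumn b : \sum_i n b i = (H./2).+1.
  by rewrite /n -big_mkcond /= big_pred1_eq.
exists (fun b i => (n b i)%:R), n; split=> b; split.
- by [].
- move=> g /hard_groupsP[b' ->]; rewrite arm_degree_hard_floors //=.
  case: eqP => // -> _; rewrite sum_block_group /n eqxx natrD natr1.
  by rewrite lerDl ler0n.
- under eq_bigr do rewrite ceiln.
  by rewrite -(big_morph Posz PoszD (erefl _)) sumn /=; lia.
- by move=> i; right; rewrite ceiln.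
- move=> g /hard_groupsP[b' ->] /=; case: eqP => // ->.
  by rewrite sum_block_group /n eqxx; lia.
Qed.

End plans.

(** From [ln y = - ln (1 / y) >= 1 - 1 / y]. *)
Lemma ln_ge_half {R : realType} (y : R) : 2 <= y -> 2^-1 <= ln y.
Proof.
move=> y2; have y0 : 0 < y by lra.
have yV : y^-1 <= 2^-1 by rewrite lef_pV2 ?posrE //; lra.
have yV0 : 0 < y^-1 by rewrite invr_gt0.
have := @le_ln1Dx R (y^-1 - 1); rewrite subrKC lnV ?posrE // => h.
by have := h _; lra.
Qed.

(** * The regret bound as an almost sure event *)

Section upper_bound_probability.
Context {R : realType} {B H : nat} (e : R).
Hypothesis e_bounds : 0 <= e <= 2^-1.
Context (sg : {ffun 'I_B -> bool}) (L : R) (n : 'I_B -> 'I_(2 * B + 1) -> nat).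
Hypothesis L_ge : 2^-1 <= L.
Hypothesis mandatory_le : forall b, (mandatory n b <= H)%N.
Context {d : measure_display} {U : measurableType d} (PU : probability U R).
Context (pi : policy R (2 * B + 1) U).
Hypothesis mpi : measurable_policy pi.
Hypothesis ucb : group_bdq_ucb (hard_floors H) n L pi.
Context {d' : measure_display} {Omega : measurableType d'} (P : probability Omega R).
Context (seed : Omega -> U) (X : 'I_(2 * B + 1) -> nat -> Omega -> measurableTypeR R).
Hypothesis env : bandit_env PU (hard_laws e sg) P seed X.

(** The bound is deterministic on tables whose entries lie in the sets [S i], which have full
    measure, so no concentration inequality enters. *)
Lemma plan_regret_le_almost_surely :
  P [set w | plan_regret (hard_floors H) n (arm_mean (hard_laws e sg)) pi (seed w) (table_at X w)
      <= 4 * Num.sqrt ((2 * B + 1)%:R * (residual (hard_floors H) n)%:R * L)] = 1%E.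
Proof.
set A := [set w | _]; have [mseed mX _] := env.
have mA : measurable A.
  pose regret (s : seq 'I_(2 * B + 1)) := comparator_value (hard_floors H) n
    (arm_mean (hard_laws e sg)) - \sum_(i <- s) arm_mean (hard_laws e sg) i.
  have := measurable_arms mpi mseed mX (fun s => regret s
    <= 4 * Num.sqrt ((2 * B + 1)%:R * (residual (hard_floors H) n)%:R * L)) (B * H)%N.
  suff E w : regret (unzip1 (run pi (seed w) (table_at X w) (B * H)))
      = plan_regret (hard_floors H) n (arm_mean (hard_laws e sg)) pi (seed w) (table_at X w).
    by congr (measurable _); apply/seteqP; split => w; rewrite /A /= E.
  by rewrite /plan_regret /policy_value horizon_hard_floors sum_arm_at.
pose S (i : 'I_(2 * B + 1)) : set (measurableTypeR R) :=
  if i == safe_arm then [set 1] else `[0, 2^-1]%classic.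
have mS i : measurable (S i).
  by rewrite /S; case: eqP => _; [exact: measurable_set1|exact: measurable_itv].
have S_arm_value i : S i (arm_value i).
  rewrite /S; case: eqP => [->|/eqP i_unsafe]; first by rewrite /= arm_value_safe.
  by rewrite /= in_itv /= arm_value_le_half // andbT; have /andP[] := @arm_value_bounds R B i.
have S01 i v : S i v -> 0 <= v <= 1.
  rewrite /S; case: eqP => _ /=; first by move=> ->; rewrite ler01 lexx.
  by rewrite in_itv /= => /andP[? ?]; apply/andP; split; lra.
have lawS i : hard_laws e sg i (S i) = 1%E.
  rewrite two_pointE ?arm_prob_bounds // !indicE mem_set; last exact: S_arm_value.
  have [->|i_unsafe] := eqVneq i safe_arm; first by rewrite arm_prob_safe mulr1 subrr mul0r addr0.
  rewrite mem_set ?mulr1 ?subrKC // /S (negPf i_unsafe) /= in_itv /= lexx /=; lra.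
have [mgood Pgood] := bandit_env_support (B * H) env mS lawS.
apply/eqP; rewrite eq_le probability_le1 //= -Pgood le_measure ?inE // => w Xw.
(* The deterministic bound asks for good entries at all indices; beyond the horizon [arm_value]
   supplies them without changing the run. *)
pose x : reward_table R (2 * B + 1) :=
  fun i s => if (s < B * H)%N then X i s w else arm_value i.
have Sx i s : S i (x i s).
  by rewrite /x; case: ltnP => [sT|_]; [exact: (Xw i (Ordinal sT))|exact: S_arm_value].
have x_safe s : x safe_arm s = 1 by have := Sx safe_arm s; rewrite /S eqxx.
have x_half i s : i != safe_arm -> x i s <= 2^-1.
  by move=> /negPf i_unsafe; have := Sx i s; rewrite /S i_unsafe /= in_itv /= => /andP[].
have x01 : in01 x by move=> i s; exact: S01 (Sx i s).
have := plan_regret_le (seed w) ucb L_ge mandatory_le x01 x_safe x_half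
  (mean_hard_laws_bounds e_bounds sg) (mean_hard_laws_safe e_bounds sg).
rewrite /A /=; congr (_ - _ <= _); rewrite /policy_value horizon_hard_floors.
apply: eq_bigr => t _; rewrite /arm_at; congr (arm_mean _ (pi _ _)).
apply: eq_run_ltn => i s st.
by rewrite /x /table_at (ltn_trans st).
Qed.

End upper_bound_probability.

Theorem proposition8 (R : realType) :
  exists c C : R, [/\ 0 < c, 0 < C &
  forall B H : nat, (1 <= B)%N -> (2 <= H)%N -> ~~ odd H ->
  exists (I : floors (2 * B + 1) B) (gb : 'I_B -> {set 'I_(2 * B + 1)})
         (family : set (arm_laws R (2 * B + 1))),
  [/\
    (* shape of the instances *)
    [/\ forall b, blen I b = H,
        finset.trivIset (groups I) /\ (forall g, g \in groups I -> #|g| = 2%N),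
        arm_degree I = 1%N,
        injective gb /\ (forall b, gb b \in groups I)
      & forall b g, g \in groups I ->
          gfloor I b g = if g == gb b then H./2 else 0%N],
    forall nu, family nu -> unit_laws nu,
    (* lower bound for every blockwise-group-fair policy *)
    (forall (d : measure_display) (U : measurableType d) (PU : probability U R)
            (pi : policy R (2 * B + 1) U),
      measurable_policy pi -> group_fair I pi ->
      forall (d' : measure_display) (Omega : measurableType d')
             (P : arm_laws R (2 * B + 1) -> probability Omega R)
             (seed : Omega -> U)
             (X : 'I_(2 * B + 1) -> nat -> Omega -> measurableTypeR R),
      (forall nu, family nu -> bandit_env PU nu (P nu) seed X) ->
      ((c * B%:R * Num.sqrt H%:R)%:E <=
       ereal_sup [set (OPTfrac I (arm_mean nu))%:E
         - 'E_(P nu) [fun w => policy_value I (arm_mean nu) pi (seed w) (table_at X w)]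
         | nu in family])%E),
    c * B%:R * Num.sqrt H%:R
      = c * Num.sqrt B%:R * Num.sqrt (horizon I)%:R :> R
  & (* upper bound for Group-BDQ-UCB against a fixed-plan comparator *)
    (exists (x : 'I_B -> 'I_(2 * B + 1) -> R) (n : 'I_B -> 'I_(2 * B + 1) -> nat),
       fractional_plan I x /\ rounding I x n) /\
    (forall (x : 'I_B -> 'I_(2 * B + 1) -> R) (n : 'I_B -> 'I_(2 * B + 1) -> nat),
      fractional_plan I x -> rounding I x n ->
      forall nu, family nu ->
      forall eta : R, 0 < eta < 1 ->
      let L := ln (2 * (2 * B + 1)%:R * (horizon I)%:R / eta) in
      forall (d : measure_display) (U : measurableType d) (PU : probability U R)
             (pi : policy R (2 * B + 1) U),
      measurable_policy pi -> group_bdq_ucb I n L pi ->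
      forall (d' : measure_display) (Omega : measurableType d')
             (P : probability Omega R) (seed : Omega -> U)
             (X : 'I_(2 * B + 1) -> nat -> Omega -> measurableTypeR R),
      bandit_env PU nu P seed X ->
      ((1 - eta)%:E <=
       P [set w | (plan_regret I n (arm_mean nu) pi (seed w) (table_at X w)
                   <= C * Num.sqrt ((2 * B + 1)%:R * (residual I n)%:R * L))%R])%E)
  ]].
Proof.
exists 100^-1, 4; split => //.
move=> B H B0 H2 evenH.
pose e : R := (4 * Num.sqrt (H./2)%:R)^-1.
have [e_bounds rate] := @le_gap_rate R B H e H2 evenH erefl.
exists (hard_floors H), block_group, (range (hard_laws e)); split.
- split=> //.
  + split; first exact: trivIset_hard_floors.
    by move=> _ /hard_groupsP[b ->]; exact: card_block_group.
  + exact: arm_degree_hard_floors.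
  + by split; [exact: block_group_inj|move=> b; exact: block_group_in].
- by move=> _ [sg _ <-]; exact: hard_laws_unit.
- move=> d U PU pi mpi fair d' Omega P seed X env.
  have env_sg sg : bandit_env PU (hard_laws e sg) (P (hard_laws e sg)) seed X.
    by apply: env; exists sg.
  have [sg gap_ge] := exists_gap_ge (H := H) e_bounds mpi env_sg.
  apply: le_trans (ereal_sup_ubound _); last by exists (hard_laws e sg); first by exists sg.
  apply: le_trans (expected_regret_ge e_bounds mpi env_sg evenH fair sg).
  by rewrite lee_fin (le_trans rate).
- rewrite horizon_hard_floors natrM sqrtrM // mulrA.
  by rewrite -[_ * _ * Num.sqrt B%:R]mulrA -expr2 sqr_sqrtr.
- split; first exact: exists_fractional_plan.
  move=> x n plan round _ [sg _ <-] eta /andP[eta0 eta1] L d U PU pi mpi ucb d' Omega P seed X env.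
  have L_ge : 2^-1 <= L.
    (* The argument of the logarithm is at least 2, since [K] and [T] are at least 1 and
       [eta < 1]. *)
    apply: ln_ge_half; rewrite horizon_hard_floors.
    have K1 : 1 <= (2 * B + 1)%:R :> R by rewrite ler1n; lia.
    have T1 : 1 <= (B * H)%:R :> R by rewrite ler1n muln_gt0 B0; lia.
    rewrite ler_pdivlMr //; nra.
  rewrite (plan_regret_le_almost_surely e_bounds L_ge
    (fun b => rounding_mandatory_le b plan round) mpi ucb env).
  by rewrite lee_fin; lra.
Qed.
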